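(* Let $G$ be a primitive graph. The following are equivalent: (1) $G\cong\mathscr{G}(N,t)$ for some labeled level-1 network $(N,t)$; (2) $G\cong\mathscr{G}(N,t)$ for some labeled network $(N,t)$ that is strong, elementary and quasi-discriminating; (3) $G$ is a polar-cat.
   Context: All graphs are finite, simple and undirected; $G[W]$, $G-v$, $\overline G$, join and cograph (no induced $P_4$) as usual. A graph $G=(V,E)$ is primitive if $|V|\ge4$ and its only modules are $\emptyset$-free trivial ones, i.e. $V$ and the singletons, where a module is $M\subseteq V$ with $N_G(x)\setminus M=N_G(y)\setminus M$ for all $x,y\in M$. Networks: a network on a finite set $X$ is a directed acyclic graph $N=(V,E)$ such that either $V=X=\{x\}$, or (N1) there is a unique root $\rho_N$ with indegree $0$ and outdegree $\ge 2$; (N2) $x\in X$ iff $x$ has outdegree $0$ and indegree $1$; (N3) every $v\notin X\cup\{\rho_N\}$ has indegree 1 and outdegree $\ge2$ (tree-vertex) or indegree 2 and outdegree $\ge1$ (hybrid-vertex). Level-1: every biconnected component of the underlying undirected graph contains at most one hybrid-vertex; then $\mathrm{lca}_N(x,y)$ is unique. A labeled network $(N,t)$ has $t:V\to\{0,1,\odot\}$ with $t(v)=\odot$ iff $v\in X$; $\mathscr{G}(N,t)$ is the graph on $X$ with $x\ne y$ adjacent iff $t(\mathrm{lca}_N(x,y))=1$. A cycle of a level-1 network is a biconnected component (of the underlying undirected graph) that is not a single vertex or edge; it consists of two directed paths (sides) from a root $\rho_C$ to its hybrid-vertex $\eta_C$, internally vertex-disjoint. $C$ is weak if one side consists of $\rho_C,\eta_C$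 only, or both sides contain exactly one vertex other than $\rho_C,\eta_C$; otherwise strong. A network is strong if it has no weak cycle. $N$ is elementary if it consists of a single cycle $C$ with $|X|+1$ vertices containing $\rho_N$ and the hybrid-vertex, together with one edge from each vertex of $C$ other than $\rho_N$ to a leaf, these leaves being pairwise distinct and forming $X$. $(N,t)$ is quasi-discriminating if $t(u)\ne t(v)$ for every edge $(u,v)$ with $u,v$ inner (non-leaf) vertices and $v$ not a hybrid-vertex. Pseudo-cographs and polar-cats: $G$ is a $(v,G_1,G_2)$-pseudo-cograph if $G_1,G_2$ are induced subgraphs and $v\in V(G)$ with (F1) $V(G)=V(G_1)\cup V(G_2)$, $V(G_1)\cap V(G_2)=\{v\}$, $|V(G_1)|,|V(G_2)|>1$; (F2) $G_1,G_2$ cographs; (F3) $G-v$ is the join or disjoint union of $G_1-v$ and $G_2-v$. A caterpillar is a rooted tree whose inner vertices each have two children and induce a path with the root at one end; two leaves with a common parent form a cherry. A cograph is caterpillar-explainable if its unique discriminating cotree (labeled tree explaining it with adjacent inner vertices labeled differently) is a caterpillar. A $(v,G_1,G_2)$-pseudo-cograph $G$ with $|V(G)|\ge4$ is a $(v,G_1,G_2)$-polar-cat if (polarizing) either $G_1,G_2$ are both connected and $G-v$ is the disjoint union of $G_1-v,G_2-v$, or both disconnected and $G-v$ is the join, and (cat) $G_1,G_2$ are caterpillar-explainable with $v$ part of a cherry in both explaining caterpillars. A polar-cat is a $(v,G_1,G_2)$-polar-cat for some $v,G_1,G_2$. *)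

(* Defs.v *)
(* Graphs: symmetric irreflexive [g : rel T] on a finType T.
   Networks: a relation [E : rel V] (directed edges u -> v) on a finType V,
   together with the leaf set [X : {set V}]. *)
From mathcomp Require Import all_boot.

Set Implicit Arguments.
Unset Strict Implicit.
Unset Printing Implicit Defensive.

Definition module (T : finType) (g : rel T) (M : {set T}) : Prop :=
  forall x y z, x \in M -> y \in M -> z \notin M -> g x z = g y z.

Definition primitive (T : finType) (g : rel T) : Prop :=
  4 <= #|T| /\
  forall M : {set T}, module g M -> M != set0 -> M = setT \/ #|M| = 1.

(* the (undirected) graph r restricted to S is connected (S empty counts as
   connected) *)
Definition restr (V : finType) (r : rel V) (S : {set V}) : rel V :=
  [rel a b | [&& a \in S, b \in S & r a b]].

Definition conn_on (V : finType) (r : rel V) (S : {set V}) : Prop :=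
  forall x y, x \in S -> y \in S -> connect (restr r S) x y.

Definition cograph_on (T : finType) (g : rel T) (W : {set T}) : Prop :=
  ~ exists a b c d : T,
      [/\ a \in W, b \in W, c \in W & d \in W] /\ uniq [:: a; b; c; d] /\
      [/\ g a b, g b c & g c d] /\ [/\ ~~ g a c, ~~ g b d & ~~ g a d].

Definition indeg (V : finType) (E : rel V) (v : V) : nat := #|[set u | E u v]|.
Definition outdeg (V : finType) (E : rel V) (v : V) : nat := #|[set w | E v w]|.

Definition undir (V : finType) (E : rel V) : rel V := [rel u v | E u v || E v u].

Definition acyclic (V : finType) (E : rel V) : Prop :=
  forall u v, E u v -> ~~ connect E v u.

Definition network (V : finType) (E : rel V) (X : {set V}) : Prop :=
  acyclic E /\
  ( (#|V| = 1 /\ X = setT)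
  \/ exists rho : V,
      [/\ indeg E rho = 0, 2 <= outdeg E rho & forall u, indeg E u = 0 -> u = rho] /\
      (forall x, x \in X <-> (outdeg E x = 0 /\ indeg E x = 1)) /\
      (forall v, v \notin X -> v <> rho ->
         (indeg E v = 1 /\ 2 <= outdeg E v) \/ (indeg E v = 2 /\ 1 <= outdeg E v))).

Definition hybrid (V : finType) (E : rel V) (v : V) : bool := indeg E v == 2.

Definition biconn (V : finType) (r : rel V) (S : {set V}) : Prop :=
  S != set0 /\ conn_on r S /\ forall v, v \in S -> conn_on r (S :\ v).

Definition block (V : finType) (r : rel V) (B : {set V}) : Prop :=
  biconn r B /\ forall B' : {set V}, B \subset B' -> biconn r B' -> B' = B.

Definition level1 (V : finType) (E : rel V) : Prop :=
  forall B, block (undir E) B -> #|[set v in B | hybrid E v]| <= 1.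

(* cycle: biconnected component that is not a single vertex or edge *)
Definition cycle_block (V : finType) (E : rel V) (B : {set V}) : Prop :=
  block (undir E) B /\ 3 <= #|B|.

Definition anc (V : finType) (E : rel V) (u v : V) : bool := connect E u v.

Definition is_lca (V : finType) (E : rel V) (x y w : V) : bool :=
  [&& anc E w x, anc E w y &
      [forall w', (anc E w' x && anc E w' y && anc E w w') ==> (w' == w)]].

Definition side (V : finType) (E : rel V) (B : {set V}) (r h : V) (p : seq V) : bool :=
  [&& path E r p, last r p == h, uniq (r :: p) & all (fun v => v \in B) p].

(* weak cycle: one side consists of rho_C, eta_C only, or both sides contain
   exactly one vertex other than rho_C, eta_C *)
Definition weak_cycle (V : finType) (E : rel V) (B : {set V}) : Prop :=
  exists r h : V,
    [/\ r \in B, (forall v, v \in B -> anc E r v), h \in B & hybrid E h] /\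
    (side E B r h [:: h] \/ forall p, side E B r h p -> size p = 2).

Definition strong (V : finType) (E : rel V) : Prop :=
  forall B, cycle_block E B -> ~ weak_cycle E B.

Definition elementary (V : finType) (E : rel V) (X : {set V}) : Prop :=
  exists C : {set V},
    cycle_block E C /\
    (forall v, v \in C \/ v \in X) /\ [disjoint C & X] /\
    #|C| = #|X| + 1 /\
    (exists h, [/\ h \in C, hybrid E h & forall w, hybrid E w -> w = h]) /\
    (exists rho, [/\ rho \in C, indeg E rho = 0,
       (forall u v, E u v -> (u \in C /\ v \in C) \/ [/\ u \in C, u <> rho & v \in X])
     & (forall v, v \in C -> v <> rho -> #|[set x in X | E v x]| = 1)]).

Inductive lab := L0 | L1 | Ldot.

Definition labeled (V : finType) (X : {set V}) (t : V -> lab) : Prop :=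
  forall v, t v = Ldot <-> v \in X.

Definition quasi_discriminating (V : finType) (E : rel V) (X : {set V}) (t : V -> lab) : Prop :=
  forall u v, E u v -> u \notin X -> v \notin X -> ~~ hybrid E v -> t u <> t v.

Definition explains_on (T : finType) (g : rel T) (W : {set T})
    (V : finType) (E : rel V) (X : {set V}) (t : V -> lab) (phi : T -> V) : Prop :=
  {in W &, injective phi} /\ X = phi @: W /\
  forall x y, x \in W -> y \in W -> x != y ->
    forall w, is_lca E (phi x) (phi y) w -> (g x y <-> t w = L1).

Definition rooted_tree (V : finType) (E : rel V) (X : {set V}) : Prop :=
  network E X /\ forall v, indeg E v <= 1.

Definition discriminating (V : finType) (E : rel V) (X : {set V}) (t : V -> lab) : Prop :=
  forall u v, E u v -> u \notin X -> v \notin X -> t u <> t v.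

Definition caterpillar (V : finType) (E : rel V) (X : {set V}) : Prop :=
  (forall v, v \notin X -> outdeg E v = 2) /\
  exists (r : V) (s : seq V),
    [/\ indeg E r = 0, path E r s, uniq (r :: s)
      & forall v, v \notin X <-> v \in r :: s].

Definition in_cherry (V : finType) (E : rel V) (X : {set V}) (x : V) : Prop :=
  x \in X /\ exists y p, [/\ y \in X, y != x, E p x & E p y].

(* G[W] is caterpillar-explainable (its discriminating cotree is a
   caterpillar) and v is part of a cherry of that caterpillar *)
Definition cat_with_cherry (T : finType) (g : rel T) (W : {set T}) (v : T) : Prop :=
  exists (V : finType) (E : rel V) (X : {set V}) (t : V -> lab) (phi : T -> V),
    [/\ rooted_tree E X, labeled X t, discriminating E X t &
        explains_on g W E X t phi] /\ caterpillar E X /\ in_cherry E X (phi v).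

(* Pseudo-cographs and polar-cats (G1 = G[W1], G2 = G[W2])              *)

Definition join_part (T : finType) (g : rel T) (v : T) (W1 W2 : {set T}) : Prop :=
  forall x y, x \in W1 :\ v -> y \in W2 :\ v -> g x y.

Definition union_part (T : finType) (g : rel T) (v : T) (W1 W2 : {set T}) : Prop :=
  forall x y, x \in W1 :\ v -> y \in W2 :\ v -> ~~ g x y.

Definition pseudo_cograph (T : finType) (g : rel T) (v : T) (W1 W2 : {set T}) : Prop :=
  [/\ W1 :|: W2 = setT, W1 :&: W2 = [set v], (1 < #|W1|) & (1 < #|W2|)] /\
  cograph_on g W1 /\ cograph_on g W2 /\
  (join_part g v W1 W2 \/ union_part g v W1 W2).

Definition polar_cat_at (T : finType) (g : rel T) (v : T) (W1 W2 : {set T}) : Prop :=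
  pseudo_cograph g v W1 W2 /\ 4 <= #|T| /\
  ( (conn_on g W1 /\ conn_on g W2 /\ union_part g v W1 W2)
  \/ (~ conn_on g W1 /\ ~ conn_on g W2 /\ join_part g v W1 W2)) /\
  cat_with_cherry g W1 v /\ cat_with_cherry g W2 v.

Definition polar_cat (T : finType) (g : rel T) : Prop :=
  exists (v : T) (W1 W2 : {set T}), polar_cat_at g v W1 W2.

(* Main.v *)
(** Condition (1) is brought to a list form.  Let [w] be a lowest vertex of the
    level-1 network having all leaves below it.  If the leaves below one child of
    [w], or below two children sharing descendants, were separated from the rest,
    then all edges across would have the colour of [w], giving two complementary
    modules.  So two children [c], [d] of [w] have common descendants, every leaf
    is below one of them, and their common descendants lie below one hybrid [h],
    because two cycles through the edge above a vertex lie in one block.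
    Descending from [c] (or [d]) to [h], the leaves that branch off at a vertex
    form a module, hence a single leaf, and so do the leaves below [h].  Thus [g]
    is given by a vertex [v] and two lists of vertices, each of whose entries sees
    all the later ones, and [v], in one colour, with one colour between the lists.
    The two caterpillars of a polar-cat give the same data.  Primitivity forces
    the colours to alternate (consecutive equal colours give a module of size
    two), and from alternating lists both the elementary network and the two
    caterpillars can be written down. *)
Require Import Defs.
From mathcomp Require Import all_boot zify.

Set Implicit Arguments.
Unset Strict Implicit.
Unset Printing Implicit Defensive.

(** * Acyclic relations and biconnected sets *)

Lemma connect_edge (V : finType) (E : rel V) u v :
  connect E u v -> u != v -> exists2 x, E u x & connect E x v.
Proof.
case/connectP=> [[|x p] /= ep ->]; first by rewrite eqxx.
case/andP: ep => eux ep _; exists x => //; apply/connectP; by exists p.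
Qed.

Lemma connect_edge_last (V : finType) (E : rel V) u v :
  connect E u v -> u != v -> exists2 x, connect E u x & E x v.
Proof.
case/connectP=> p; elim/last_ind: p => [|p x _] /=; first by move=> _ ->; rewrite eqxx.
rewrite rcons_path last_rcons => /andP [ep ex] -> _.
by exists (last u p) => //; apply/connectP; exists p.
Qed.

Lemma acyclic_anti (V : finType) (E : rel V) u v :
  acyclic E -> connect E u v -> connect E v u -> u = v.
Proof.
move=> acE uv vu; apply/eqP; apply: contraT => nuv.
have [x ux xv] := connect_edge uv nuv.
by have := acE _ _ ux; rewrite (connect_trans xv vu).
Qed.

Lemma acyclic_irr (V : finType) (E : rel V) u : acyclic E -> ~~ E u u.
Proof. by move=> acE; apply/negP => /acE; rewrite connect0. Qed.

(** A vertex satisfying [P] with fewest descendants is lowest: by acyclicity a proper descendant has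
    strictly fewer. *)
Lemma acyclic_lowest (V : finType) (E : rel V) (P : pred V) v0 :
  acyclic E -> P v0 ->
  exists2 w, P w & forall m, P m -> connect E w m -> m = w.
Proof.
move=> acE Pv0.
case: (arg_minnP (fun v => #|[set q | connect E v q]|) Pv0) => w Pw wmin.
exists w => // m Pm wm; apply/eqP; apply: contraT => nmw.
have := wmin m Pm; rewrite leqNgt => /negP; case; apply: proper_card.
apply/properP; split.
  by apply/subsetP=> q; rewrite !inE; apply: connect_trans.
exists w; rewrite !inE ?connect0 //.
by apply/negP => mw; rewrite (acyclic_anti acE wm mw) eqxx in nmw.
Qed.

Lemma restrE (V : finType) (r : rel V) S a b :
  restr r S a b = [&& a \in S, b \in S & r a b].
Proof. by []. Qed.

Lemma undirE (V : finType) (E : rel V) a b : undir E a b = E a b || E b a.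
Proof. by []. Qed.

Lemma restr_sym (V : finType) (r : rel V) S : symmetric r -> symmetric (restr r S).
Proof. by move=> rs x y; rewrite !restrE rs andbCA. Qed.

Lemma undir_sym (V : finType) (E : rel V) : symmetric (undir E).
Proof. by move=> x y; rewrite !undirE orbC. Qed.

Lemma connect_restr_sym (V : finType) (r : rel V) S :
  symmetric r -> connect_sym (restr r S).
Proof. by move=> rs; apply: sym_connect_sym; apply: restr_sym. Qed.

Lemma connect_restrS (V : finType) (r : rel V) (S1 S2 : {set V}) x y :
  S1 \subset S2 -> connect (restr r S1) x y -> connect (restr r S2) x y.
Proof.
move=> /subsetP sS; apply: connect_sub => a b; rewrite restrE => /and3P [/sS ha /sS hb rab].
by apply: connect1; rewrite restrE ha hb.
Qed.

Lemma conn_on_hub (V : finType) (r : rel V) (S : {set V}) c :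
  symmetric r -> (forall q, q \in S -> connect (restr r S) q c) -> conn_on r S.
Proof.
move=> rs h x y xS yS; apply: connect_trans (h x xS) _.
by rewrite (connect_restr_sym _ rs) h.
Qed.

Lemma connect_restr_undir (V : finType) (E : rel V) (S : {set V}) a b :
  (forall q, connect E a q -> connect E q b -> q \in S) ->
  connect E a b -> connect (restr (undir E) S) a b.
Proof.
move=> h /connectP [p]; elim: p a h => [|z p IH] a h /=; first by move=> _ ->.
case/andP=> eaz ep bE.
have zb : connect E z b by apply/connectP; exists p.
have ab : connect E a b by apply: connect_trans zb; apply: connect1.
have az := connect1 eaz.
apply: (@connect_trans _ _ z); last first.
  by apply: IH => // q zq; apply: h; apply: connect_trans zq.
apply: connect1; rewrite restrE undirE eaz /= andbT; apply/andP; split; apply: h => //.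
Qed.

Definition interval (V : finType) (E : rel V) a b : {set V} :=
  [set q | connect E a q && connect E q b].

(** After deleting an inner [v], a vertex not below [v] still climbs to [r] and one strictly below
    [v] still descends to [y], so only the connection of [r] and [y] has to be assumed. If an
    endpoint is deleted, the other one is a hub. *)
Lemma interval_biconn (V : finType) (E : rel V) r y :
  acyclic E -> connect E r y ->
  (forall v, v != r -> v != y -> v \in interval E r y ->
     connect (restr (undir E) (interval E r y :\ v)) r y) ->
  biconn (undir E) (interval E r y).
Proof.
move=> acE ry h; set S := interval E r y.
have us := @undir_sym V E.
have rS : r \in S by rewrite inE connect0.
have up (R : {set V}) q : q \in S ->
    (forall m, m \in S -> connect E m q -> m \in R) ->
    connect (restr (undir E) R) q r.
  rewrite inE => /andP [rq qy] hR; rewrite (connect_restr_sym _ us).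
  apply: connect_restr_undir => // m rm mq; apply: hR => //.
  by rewrite inE rm (connect_trans mq qy).
have dn (R : {set V}) q : q \in S ->
    (forall m, m \in S -> connect E q m -> m \in R) ->
    connect (restr (undir E) R) q y.
  rewrite inE => /andP [rq qy] hR.
  apply: connect_restr_undir => // m qm my; apply: hR => //.
  by rewrite inE my (connect_trans rq qm).
split; first by apply/set0Pn; exists r.
split; first by apply: (@conn_on_hub _ _ _ r) => // q qS; apply: up.
move=> v vS; have [vr|nvr] := eqVneq v r.
  apply: (@conn_on_hub _ _ _ y) => // q; rewrite in_setD1 => /andP [qv qS].
  apply: dn => // m mS qm; rewrite in_setD1 mS andbT.
  apply: contra qv => /eqP mv; apply/eqP; apply: (acyclic_anti acE); first by rewrite -mv.
  by rewrite vr; move: qS; rewrite inE => /andP [].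
apply: (@conn_on_hub _ _ _ r) => // q; rewrite in_setD1 => /andP [qv qS].
have [vq|nvq] := boolP (connect E v q); last first.
  apply: up => // m mS mq; rewrite in_setD1 mS andbT.
  by apply: contra nvq => /eqP <-.
have [vy|nvy] := eqVneq v y.
  move: qS; rewrite inE => /andP [_ qy]; rewrite -vy in qy.
  by rewrite (acyclic_anti acE qy vq) eqxx in qv.
apply: (@connect_trans _ _ y); last by rewrite (connect_restr_sym _ us); apply: h.
apply: dn => // m mS qm; rewrite in_setD1 mS andbT.
apply: contra qv => /eqP mv; rewrite mv in qm.
by rewrite (acyclic_anti acE qm vq).
Qed.

(* [r] is a lowest common ancestor of [u] and the parent [y'] of [y], so the two
   descents from [r] to [y], through [u] and through [y'], avoid each other. *)
Lemma ear_biconn (V : finType) (E : rel V) r u y' y :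
  acyclic E -> connect E r u -> connect E r y' ->
  (forall m, connect E r m -> connect E m u -> connect E m y' -> m = r) ->
  ~~ connect E u y' -> E y' y -> connect E u y ->
  biconn (undir E) (interval E r y).
Proof.
move=> acE ru ry' rlow uy' ey uy.
have ry := connect_trans ru uy.
have y'y := connect1 ey.
apply: interval_biconn => // v nvr nvy; rewrite inE => /andP [rv vy].
(* A vertex above [y'] is neither above nor below [u], so the route through [u] avoids it; any other
   [v] is avoided by the route through [y']. *)
have [vy'|nvy'] := boolP (connect E v y').
  have nvu : ~~ connect E v u.
    by apply: contra nvr => vu; apply/eqP/rlow.
  have nuv : ~~ connect E u v.
    by apply: contra uy' => uv; apply: connect_trans vy'.
  apply: (@connect_trans _ _ u); apply: connect_restr_undir => // q q1 q2.
    rewrite in_setD1 inE q1 (connect_trans q2 uy) !andbT.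
    by apply: contra nvu => /eqP <-.
  rewrite in_setD1 inE q2 (connect_trans ru q1) !andbT.
  by apply: contra nuv => /eqP <-.
apply: (@connect_trans _ _ y').
  apply: connect_restr_undir => // q q1 q2.
  rewrite in_setD1 inE q1 (connect_trans q2 y'y) !andbT.
  by apply: contra nvy' => /eqP <-.
apply: connect1; rewrite restrE undirE ey !inE ry' y'y ry connect0 /= !andbT [y == v]eq_sym nvy andbT.
by apply: contra nvy' => /eqP <-; rewrite connect0.
Qed.

(** Whatever vertex is deleted, one of the common vertices [x], [y] survives and is a hub for both
    sets. *)
Lemma biconn_union (V : finType) (r : rel V) (S1 S2 : {set V}) x y :
  symmetric r -> biconn r S1 -> biconn r S2 -> x != y ->
  x \in S1 -> x \in S2 -> y \in S1 -> y \in S2 -> biconn r (S1 :|: S2).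
Proof.
move=> rs [n1 [c1 b1]] [n2 [c2 b2]] nxy x1 x2 y1 y2.
have delS v (S : {set V}) : S != set0 -> conn_on r S ->
    (forall w, w \in S -> conn_on r (S :\ w)) -> conn_on r (S :\ v).
  move=> _ cS bS; have [vS|nvS] := boolP (v \in S); first exact: bS.
  by have -> : S :\ v = S by apply/setDidPl; rewrite disjoint_sym disjoints1.
split; first by apply/set0Pn; exists x; rewrite inE x1.
split.
  apply: (@conn_on_hub _ _ _ x) => // q; rewrite inE => /orP [] qS.
    by apply: connect_restrS (c1 q x qS x1); apply: subsetUl.
  by apply: connect_restrS (c2 q x qS x2); apply: subsetUr.
move=> v _.
have [z [z1 z2 zv]] : exists z, [/\ z \in S1, z \in S2 & z != v].
  have [xv|] := eqVneq x v; last by exists x.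
  by exists y; rewrite -xv eq_sym.
apply: (@conn_on_hub _ _ _ z) => // q; rewrite in_setD1 inE => /andP [qv /orP []] qS.
  apply: (@connect_restrS _ _ (S1 :\ v)); first by apply: setSD; apply: subsetUl.
  by apply: (delS v _ n1 c1 b1); rewrite in_setD1 ?qv ?zv.
apply: (@connect_restrS _ _ (S2 :\ v)); first by apply: setSD; apply: subsetUr.
by apply: (delS v _ n2 c2 b2); rewrite in_setD1 ?qv ?zv.
Qed.

(** [level1] speaks of blocks only, so the biconnected set is enlarged until it is maximal, by
    induction on the size of its complement. *)
Lemma level1_biconn (V : finType) (E : rel V) (B : {set V}) h1 h2 :
  level1 E -> biconn (undir E) B -> h1 \in B -> h2 \in B ->
  hybrid E h1 -> hybrid E h2 -> h1 = h2.
Proof.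
move=> l1 bB h1B h2B y1 y2; apply/eqP; apply: contraT => /negP nh; exfalso.
have [n] := ubnP #|~: B|; elim: n B bB h1B h2B => // n IH B bB h1B h2B ltn.
have blB : block (undir E) B.
  split=> // B' sB bB'; apply/eqP; apply: contraT => nB; exfalso.
  have pB : B \proper B' by rewrite properEneq eq_sym nB.
  apply: (IH B') => //; try exact: (subsetP sB).
  rewrite -ltnS; apply: leq_trans ltn; rewrite ltnS; apply: proper_card.
  by rewrite properC.
have := l1 B blB; apply/negP; rewrite -ltnNge.
apply: (@leq_trans #|[set h1; h2]|); first by rewrite cards2; move/negP: nh => ->.
apply/subset_leq_card/subsetP => z; rewrite !inE => /orP [] /eqP ->; apply/andP; by split.
Qed.

(** * Hybrid vertices of level-1 networks *)

Lemma acyclic_highest (V : finType) (E : rel V) (P : pred V) v0 :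
  acyclic E -> P v0 ->
  exists2 w, P w & forall m, P m -> connect E m w -> m = w.
Proof.
move=> acE Pv0.
have rev x y : connect [rel x y | E y x] x y = connect E y x.
  exact: connect_rev.
have acR : acyclic [rel x y | E y x].
  by move=> u v /= /acE; rewrite rev.
have [w Pw wl] := acyclic_lowest acR Pv0.
by exists w => // m Pm mw; apply: wl => //; rewrite rev.
Qed.

Lemma card_set_gt1 (V : finType) (P : pred V) x y :
  P x -> P y -> x != y -> 1 < #|[set u | P u]|.
Proof.
move=> Px Py nxy; apply: (@leq_trans #|[set x; y]|); first by rewrite cards2 nxy.
by apply/subset_leq_card/subsetP => z; rewrite !inE => /orP [] /eqP ->.
Qed.

Lemma card_set_gt2 (V : finType) (P : pred V) x y z :
  P x -> P y -> P z -> x != y -> x != z -> y != z -> 2 < #|[set u | P u]|.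
Proof.
move=> Px Py Pz nxy nxz nyz; apply: (@leq_trans #|[set x; y; z]|).
  by rewrite -setUA cardsU1 cards2 !inE negb_or nxy nxz nyz.
by apply/subset_leq_card/subsetP => q; rewrite !inE => /orP [/orP [] | ] /eqP ->.
Qed.

(** The second alternative of [network] with its root as a parameter; the one-vertex network is
    excluded. *)
Definition proper_network (V : finType) (E : rel V) (X : {set V}) (rho : V) : Prop :=
  [/\ acyclic E, indeg E rho = 0, 2 <= outdeg E rho & forall u, indeg E u = 0 -> u = rho] /\
  (forall x, x \in X <-> (outdeg E x = 0 /\ indeg E x = 1)) /\
  (forall v, v \notin X -> v <> rho ->
     (indeg E v = 1 /\ 2 <= outdeg E v) \/ (indeg E v = 2 /\ 1 <= outdeg E v)).

Lemma network_proper (V : finType) (E : rel V) (X : {set V}) :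
  network E X -> 1 < #|V| -> exists rho, proper_network E X rho.
Proof. by case=> ac [[-> _] //|[rho [[h1 h2 h3] [h4 h5]]]] _; exists rho. Qed.

Section ProperNetwork.

Variables (V : finType) (E : rel V) (X : {set V}) (rho : V).
Hypothesis net : proper_network E X rho.

Let acE : acyclic E. Proof. by case: net => [[]]. Qed.

Lemma indeg_gt0 u v : E u v -> 0 < indeg E v.
Proof. by move=> uv; apply/card_gt0P; exists u; rewrite inE. Qed.

Lemma outdeg_gt0 u v : E u v -> 0 < outdeg E u.
Proof. by move=> uv; apply/card_gt0P; exists v; rewrite inE. Qed.

Lemma leaf_no_child u v : E u v -> u \notin X.
Proof.
move=> /outdeg_gt0 ouv; apply/negP => /(proj1 (proj1 net.2 u)) [o _].
by rewrite o in ouv.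
Qed.

Lemma leaf_connect x z : x \in X -> connect E x z -> z = x.
Proof.
move=> xX xz; apply/eqP; apply: contraT => nzx.
rewrite eq_sym in nzx; have [y xy _] := connect_edge xz nzx.
by have := leaf_no_child xy; rewrite xX.
Qed.

Lemma two_parents_hybrid a b y : E a y -> E b y -> a != b -> hybrid E y.
Proof.
move=> ay bY nab; have i2 := card_set_gt1 (P := fun u => E u y) ay bY nab.
case: net => [[_ r0 _ _] [lf inn]].
have [yX|nyX] := boolP (y \in X).
  by have [_ i1] := proj1 (lf y) yX; rewrite -/(indeg E y) i1 in i2.
have nr : y <> rho by move=> yr; move: i2; rewrite -/(indeg E y) yr r0.
have [[i1 _]|[i1 _]] := inn y nyX nr.
  by rewrite -/(indeg E y) i1 in i2.
by rewrite /hybrid i1.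
Qed.

Lemma hybrid_parents a b c y : hybrid E y -> E a y -> E b y -> E c y ->
  [|| a == b, a == c | b == c].
Proof.
move=> /eqP hy ay bY cy; apply: contraT; rewrite !negb_or => /and3P [n1 n2 n3].
have := card_set_gt2 (P := fun u => E u y) ay bY cy n1 n2 n3.
by rewrite -/(indeg E y) hy.
Qed.

Lemma nonhybrid_two_children u c :
  E u c -> ~~ hybrid E u -> exists2 d, E u d & d != c.
Proof.
move=> uc nh; case: net => [[_ _ o2 _] [_ inn]].
have o2' : 1 < outdeg E u.
  have [->//|nr] := eqVneq u rho.
  have [[]//|[i2 _]] := inn u (leaf_no_child uc) (elimN eqP nr).
  by rewrite /hybrid i2 in nh.
have : [exists d, E u d && (d != c)].
  apply: contraT; rewrite negb_exists => /forallP h; move: o2'; rewrite ltnNge.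
  case/negP; apply: (@leq_trans #|[set c]|); last by rewrite cards1.
  apply/subset_leq_card/subsetP => z; rewrite !inE => uz.
  by have := h z; rewrite uz /= negbK.
by case/existsP => d /andP [ud dc]; exists d.
Qed.

Lemma root_above v : connect E rho v.
Proof.
apply: contraT => nv; exfalso.
have [w nw wh] := acyclic_highest (P := fun v => ~~ connect E rho v) acE nv.
have [i0|] := posnP (indeg E w).
  case: net => [[_ _ _ ru] _]; move: nw; by rewrite (ru w i0) connect0.
case/card_gt0P => p; rewrite inE => pw.
have [rp|np] := boolP (connect E rho p).
  by rewrite (connect_trans rp (connect1 pw)) in nw.
by have e := wh p np (connect1 pw); have := acyclic_irr w acE; rewrite -{1}e pw.
Qed.

Lemma leaf_below v : exists2 x, x \in X & connect E v x.
Proof.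
have [w vw wl] := acyclic_lowest (P := connect E v) acE (connect0 E v).
have o0 : outdeg E w = 0.
  apply/eqP; rewrite -leqn0 leqNgt; apply/negP => /card_gt0P [c]; rewrite inE => wc.
  have e : c = w by apply: wl (connect1 wc); apply: connect_trans (connect1 wc).
  by have := acyclic_irr w acE; rewrite -{2}e wc.
exists w => //; apply: contraT => nw; exfalso.
case: net => [[_ _ o2 _] [_ inn]].
have [wr|nr] := eqVneq w rho; first by rewrite -wr o0 in o2.
by case: (inn w nw (elimN eqP nr)) => [[_]|[_]]; rewrite o0.
Qed.

(* The hybrid vertex [y] lies below [u] but one of its parents does not; this
   includes [u = y]. *)
Definition exit u y :=
  [&& hybrid E y, connect E u y & [exists q, E q y && ~~ connect E u q]].

Lemma exitP u y : reflect
  [/\ hybrid E y, connect E u y & exists2 q, E q y & ~~ connect E u q] (exit u y).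
Proof.
apply: (iffP and3P) => [[h1 h2 /existsP [q /andP [h3 h4]]]|[h1 h2 [q h3 h4]]].
  by split=> //; exists q.
by split=> //; apply/existsP; exists q; rewrite h3.
Qed.

(** [r] is a lowest common ancestor of [u] and of a parent of [y] not below [u]. As [r] lies
    strictly above [u], the interval also contains a parent of [u], which allows two such intervals
    to be glued. *)
Lemma exit_ear u y : exit u y ->
  exists r, [/\ connect E r u, r != u & biconn (undir E) (interval E r y)].
Proof.
case/exitP => hy uy [q qy nuq].
have [r /andP [ru rq] rl] :=
  acyclic_lowest (P := fun m => connect E m u && connect E m q) acE
    (introT andP (conj (root_above u) (root_above q))).
exists r; split=> //; first by apply: contra nuq => /eqP <-.
apply: (ear_biconn acE ru rq _ nuq qy uy) => m rm mu mq.
by apply: rl => //; rewrite mu.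
Qed.

(** A lower common ancestor would lie below some child of [u]. *)
Lemma branch_lca u x z : connect E u x -> connect E u z ->
  (forall c, E u c -> connect E c x -> ~~ connect E c z) -> is_lca E x z u.
Proof.
move=> ux uz h; apply/and3P; split=> //; apply/forallP => m; apply/implyP.
case/andP => /andP [mx mz] um; apply: contraT; rewrite eq_sym => num.
have [c uc cm] := connect_edge um num.
by have := h c uc (connect_trans cm mx); rewrite /anc in mz; rewrite (connect_trans cm mz).
Qed.

Lemma no_edge_back w c : E w c -> ~~ connect E c w.
Proof. exact: acE. Qed.

(** [h] is a highest common descendant above [z]. It has a parent reached through [c] and one
    through [d] ([w] itself if the child is [h]). Neither is below the other child, which would give
    a higher common descendant or a directed cycle; so they differ and [h] is hybrid. *)
Lemma exit_of_merge w c d z : E w c -> E w d -> c != d ->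
  connect E c z -> connect E d z ->
  exists h, [/\ exit c h, exit d h & connect E h z].
Proof.
move=> wc wd ncd cz dz.
have [h /and3P [ch dh hz] hh] := acyclic_highest
  (P := fun m => [&& connect E c m, connect E d m & connect E m z]) acE
  (introT and3P (And3 cz dz (connect0 E z))).
exists h.
have parent a b : E w a -> E w b -> connect E a h -> connect E b h ->
   (forall m, connect E a m -> connect E b m -> connect E m h -> m = h) ->
   exists q, [/\ E q h, (a != h) -> connect E a q, (a = h -> q = w) & ~~ connect E b q].
  move=> wa wb ah bh hi; have [e|nah] := eqVneq a h.
    by exists w; split=> //; rewrite ?e -1?e //; apply: no_edge_back.
  have [q aq qh] := connect_edge_last ah nah; exists q; split=> //.
    by move=> e; rewrite e eqxx in nah.
  apply/negP => bq; have e := hi q aq bq (connect1 qh).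
  by have := acyclic_irr h acE; rewrite -{1}e qh.
have hh' m : connect E c m -> connect E d m -> connect E m h -> m = h.
  by move=> cm dm mh; apply: hh => //; rewrite cm dm (connect_trans mh hz).
have [q1 [q1h cq1 cw dq1]] := parent c d wc wd ch dh hh'.
have [q2 [q2h dq2 dw cq2]] := parent d c wd wc dh ch (fun m a b => hh' m b a).
have nq : q1 != q2.
  apply: contraTneq ncd => e; rewrite negbK; have [ec|nc] := eqVneq c h.
    have [ed|nd] := eqVneq d h; first by rewrite ed eq_sym ec eqxx.
    by move: dq1; rewrite e (dq2 nd).
  by move: cq2; rewrite -e (cq1 nc).
have hyb := two_parents_hybrid q1h q2h nq.
by split=> //; apply/exitP; split=> //; [exists q2|exists q1].
Qed.

Hypothesis l1 : level1 E.

(** The biconnected interval of [exit_ear] contains every vertex between [u] and [y]. *)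
Lemma exit_hybrid u m y :
  exit u y -> connect E u m -> connect E m y -> hybrid E m -> m = y.
Proof.
move=> ex um my hm; have [r [ru nru bc]] := exit_ear ex.
have [hy uy _] := exitP _ _ ex.
apply: (level1_biconn l1 bc) => //; rewrite inE ?connect0 ?andbT.
  by rewrite (connect_trans ru um).
exact: connect_trans uy.
Qed.

(** A hybrid [u] is itself both exits. Otherwise the two intervals of [exit_ear] share [u] and its
    only parent, so their union is biconnected and contains at most one hybrid vertex. *)
Lemma exit_inj u y1 y2 : exit u y1 -> exit u y2 -> y1 = y2.
Proof.
move=> e1 e2.
have [hy1 uy1 _] := exitP _ _ e1; have [hy2 uy2 _] := exitP _ _ e2.
have [hu|nhu] := boolP (hybrid E u).
  by rewrite -(exit_hybrid e1 (connect0 _ u)) // -(exit_hybrid e2 (connect0 _ u)).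
have [r1 [r1u n1 b1]] := exit_ear e1; have [r2 [r2u n2 b2]] := exit_ear e2.
have [p1 rp1 p1u] := connect_edge_last r1u n1.
have [p2 rp2 p2u] := connect_edge_last r2u n2.
have ep : p2 = p1.
  by apply/eqP; apply: contraNT nhu => np; apply: two_parents_hybrid np.
rewrite ep in rp2.
have npu : p1 != u by apply: contraTneq p1u => ->; apply: acyclic_irr.
have p1y1 := connect_trans (connect1 p1u) uy1.
have p1y2 := connect_trans (connect1 p1u) uy2.
have bc := @biconn_union _ _ _ _ p1 u (@undir_sym _ E) b1 b2 npu.
apply: (level1_biconn l1 (bc _ _ _ _)) => //; rewrite !inE ?connect0 ?andbT;
  rewrite ?rp1 ?rp2 ?p1y1 ?p1y2 ?r1u ?r2u ?uy1 ?uy2 //.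
  by rewrite (connect_trans r1u uy1).
by rewrite (connect_trans r2u uy2) orbT.
Qed.

(** The second disjunct is the case where [c] is [h] itself, entered by the edge from [w]. *)
Lemma exit_via w c h : E w c -> exit c h ->
  exists2 q, E q h & connect E c q || (c == h) && (q == w).
Proof.
move=> wc /exitP [hh ch _]; have [e|nch] := eqVneq c h.
  by exists w; rewrite -?e // !eqxx orbT.
by have [q cq qh] := connect_edge_last ch nch; exists q; rewrite // cq.
Qed.

(** A parent of [h] below both children would be below a common exit of them. By uniqueness that
    exit is [h], which would then lie above its own parent. *)
Lemma exit_via_neq w c d h q1 q2 : E w c -> E w d -> c != d ->
  exit c h -> exit d h -> E q1 h -> E q2 h ->
  connect E c q1 || (c == h) && (q1 == w) ->
  connect E d q2 || (d == h) && (q2 == w) -> q1 != q2.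
Proof.
move=> wc wd ncd ec ed q1h q2h v1 v2; apply/eqP => e; rewrite -{}e in v2 q2h *.
case/orP: v1 => [c1|/andP [/eqP e1 /eqP f1]]; case/orP: v2 => [d1|/andP [/eqP e2 /eqP f2]].
- have [h' [ec' _ h'q]] := exit_of_merge wc wd ncd c1 d1.
  by move: (acE q1h); rewrite (exit_inj ec ec') h'q.
- by move: (no_edge_back wc); rewrite -f2 c1.
- by move: (no_edge_back wd); rewrite -f1 d1.
- by rewrite e1 e2 eqxx in ncd.
Qed.

Lemma exit_three_children w c d e h : E w c -> E w d -> E w e ->
  c != d -> c != e -> d != e -> exit c h -> exit d h -> ~~ exit e h.
Proof.
move=> wc wd we n1 n2 n3 ec ed; apply/negP => ee.
have [q1 p1 v1] := exit_via wc ec.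
have [q2 p2 v2] := exit_via wd ed.
have [q3 p3 v3] := exit_via we ee.
have hh : hybrid E h by case/exitP: ec.
have := hybrid_parents hh p1 p2 p3.
rewrite (negbTE (exit_via_neq wc wd n1 ec ed p1 p2 v1 v2)).
rewrite (negbTE (exit_via_neq wc we n2 ec ee p1 p3 v1 v3)).
by rewrite (negbTE (exit_via_neq wd we n3 ed ee p2 p3 v2 v3)).
Qed.

Lemma exit_child u c h : exit u h -> E u c -> connect E c h -> exit c h.
Proof.
case/exitP => hh uh [q qh nuq] uc ch; apply/exitP; split=> //; exists q => //.
by apply: contra nuq; apply: connect_trans; apply: connect1.
Qed.

(** A common descendant would make [h] an exit of both children and give two distinct parents of [h]
    below [u]. With the parent not below [u] these are three, too many for a hybrid vertex. *)
Lemma exit_disjoint u c d h z : exit u h -> E u c -> E u d -> c != d ->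
  connect E c h -> connect E c z -> ~~ connect E d z.
Proof.
move=> eu uc ud ncd ch cz; apply/negP => dz.
have ec := exit_child eu uc ch.
have [h' [ec' ed _]] := exit_of_merge uc ud ncd cz dz.
rewrite -{h' ec'}(exit_inj ec ec') in ed.
have [q1 p1 v1] := exit_via uc ec.
have [q2 p2 v2] := exit_via ud ed.
have n12 := exit_via_neq uc ud ncd ec ed p1 p2 v1 v2.
have [hh _ [q3 p3 nuq3]] := exitP _ _ eu.
have below a q : E u a -> connect E a q || (a == h) && (q == u) -> connect E u q.
  move=> ua /orP [|/andP [_ /eqP ->]] //; apply: connect_trans; exact: connect1.
have := hybrid_parents hh p1 p2 p3; rewrite (negbTE n12) /= => /orP [] /eqP e.
  by rewrite -e (below c q1) in nuq3.
by rewrite -e (below d q2) in nuq3.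
Qed.

End ProperNetwork.

(** * Primitive graphs explained by level-1 networks *)

(* [s] read from the top of a caterpillar: every entry sees all later ones, and
   the bottom part [H], in a single colour. *)
Fixpoint caterp (T : finType) (g : rel T) (H : {set T}) (s : seq T) : Prop :=
  if s is x :: s' then
    (exists c, forall y, (y \in s') || (y \in H) -> g x y = c) /\ caterp g H s'
  else True.

(** In a network [v] is the leaf below the hybrid vertex and [a], [b] are the sides; in a polar-cat
    [v] is the vertex common to the two parts. *)
Definition two_caterps (T : finType) (g : rel T) : Prop :=
  exists v a b, [/\ uniq (v :: a ++ b), (forall x, x \in v :: a ++ b),
    caterp g [set v] a, caterp g [set v] b &
    exists t0, forall x y, x \in a -> y \in b -> g x y = t0].

Lemma caterp_bottom (T : finType) (g : rel T) (H : {set T}) s z :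
  caterp g H s -> z \in s -> exists c, forall y, y \in H -> g z y = c.
Proof.
elim: s => //= x s IH [[c hc] cs]; rewrite inE => /orP [/eqP ->|zs].
  by exists c => y yH; rewrite hc // yH orbT.
exact: IH.
Qed.

Lemma primitive_module1 (T : finType) (g : rel T) (M : {set T}) x :
  primitive g -> module g M -> x \in M -> M != setT -> M = [set x].
Proof.
move=> [_ pr] mM xM nM.
case: (pr M mM) => [|e|/eqP/cards1P [y e]]; first by apply/set0Pn; exists x.
  by rewrite e eqxx in nM.
by move: xM; rewrite e inE => /eqP ->.
Qed.

(** [A] and its complement are both modules, hence singletons, which leaves only two vertices. *)
Lemma primitive_bipartition (T : finType) (g : rel T) (A : {set T}) x z c :
  symmetric g -> primitive g -> x \in A -> z \notin A ->
  (forall x z, x \in A -> z \notin A -> g x z = c) -> False.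
Proof.
move=> gs pr xA zA h.
have mA : module g A by move=> a b d aA bA dA; rewrite !h.
have mC : module g (~: A).
  by move=> a b d; rewrite !inE negbK => aA bA dA; rewrite ![g _ d]gs !h.
have nA : A != setT by apply: contraNneq zA => ->.
have nC : ~: A != setT.
  by apply: contraTneq xA => e; have := in_setT x; rewrite -e inE.
have zC : z \in ~: A by rewrite inE.
have eA := primitive_module1 pr mA xA nA; have eC := primitive_module1 pr mC zC nC.
have := cardsC A; rewrite eC eA !cards1 => e.
by have := proj1 pr; rewrite -e.
Qed.

Definition is_one (l : lab) : bool := if l is L1 then true else false.

Lemma explains_color (T : finType) (g : rel T) (W : {set T}) (V : finType)
    (E : rel V) (X : {set V}) (t : V -> lab) (phi : T -> V) x y w :
  explains_on g W E X t phi -> x \in W -> y \in W -> x != y ->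
  is_lca E (phi x) (phi y) w -> g x y = is_one (t w).
Proof.
move=> [_ [_ h]] xW yW nxy lw; have [h1 h2] := h x y xW yW nxy w lw.
apply/idP/idP => [/h1 -> //|]; by case: (t w) h2 => //= h2 _; apply: h2.
Qed.

Definition leaves_below (T V : finType) (E : rel V) (phi : T -> V) u : {set T} :=
  [set x | connect E u (phi x)].

Section Level1.

Variables (T : finType) (g : rel T) (V : finType) (E : rel V) (X : {set V}).
Variables (rho : V) (t : V -> lab) (phi : T -> V).
Hypothesis gs : symmetric g.
Hypothesis pr : primitive g.
Hypothesis net : proper_network E X rho.
Hypothesis l1 : level1 E.
Hypothesis ex : explains_on g setT E X t phi.

Let acE : acyclic E. Proof. by case: net => [[]]. Qed.
Let L := leaves_below E phi.

Let phi_inj : injective phi.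
Proof. by move=> x y; apply: ex.1; rewrite inE. Qed.

Lemma leaf_belowT v : exists x, x \in L v.
Proof.
have [y yX vy] := leaf_below net v.
move: yX; rewrite ex.2.1 => /imsetP [x _ e]; exists x; by rewrite inE -e.
Qed.

Lemma color_lca x y w : x != y -> is_lca E (phi x) (phi y) w -> g x y = is_one (t w).
Proof. by move=> nxy; apply: (explains_color ex); rewrite ?inE. Qed.

Lemma color_branch u x z : x \in L u -> z \in L u -> x != z ->
  (forall c, E u c -> x \in L c -> z \notin L c) -> g x z = is_one (t u).
Proof.
rewrite !inE => ux uz nxz h; apply: color_lca => //; apply: (branch_lca ux uz).
by move=> c uc cx; have := h c uc; rewrite !inE; apply.
Qed.

Lemma leaves_below_child u c x : E u c -> x \in L c -> x \in L u.
Proof. by rewrite !inE => uc; apply: connect_trans; apply: connect1. Qed.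

(* Descending one side of the cycle whose hybrid vertex is [h]: the leaves that
   branch off at a vertex [u] form a module, hence a single leaf. *)
Lemma side_caterp u h : exit E u h ->
  (forall x y z, x \in L u -> x \notin L h -> y \in L u -> y \notin L h ->
     z \notin L u -> g x z = g y z) ->
  exists a, [/\ uniq a, (forall x, (x \in L u) = (x \in L h) || (x \in a)),
    (forall x, x \in a -> x \notin L h) & caterp g (L h) a].
Proof.
move=> eu; have [_ /connectP [p ep hE] _] := exitP _ _ _ eu.
elim: p u ep hE eu => [|c p IH] u /=.
  by move=> _ -> _ _; exists [::]; split=> // x; rewrite orbF.
case/andP=> uc ep hE eu mod.
have ch : connect E c h by apply/connectP; exists p.
have ec := exit_child eu uc ch.
have nuh : u != h.
  by apply/eqP => e; have := no_edge_back net uc; rewrite e ch.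
(* A hybrid vertex between [u] and its exit is the exit itself. So [u] is not hybrid and has a
   second child, below which some leaf branches off. *)
have nhu : ~~ hybrid E u.
  apply: contra nuh => hu; have [_ uh _] := exitP _ _ _ eu.
  by rewrite (exit_hybrid net l1 eu (connect0 _ u) uh hu).
have [d ud ndc] := nonhybrid_two_children net uc nhu.
have dis d' z : E u d' -> d' != c -> z \in L c -> z \notin L d'.
  rewrite !inE => ud' nd' cz; apply: (exit_disjoint net l1 eu uc ud' _ ch cz).
  by rewrite eq_sym.
have hc x : x \in L h -> x \in L c by rewrite !inE; apply: connect_trans.
have colA x z : x \in L u -> x \notin L c -> z \in L c -> g x z = is_one (t u).
  move=> xu xc zc; apply: color_branch => //.
  - exact: (leaves_below_child uc).
  - by apply: contraTneq zc => <-.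
  move=> e ue xe; have [ee|ne] := eqVneq e c; first by rewrite -ee xe in xc.
  exact: dis.
have modA x y z : x \in L u -> x \notin L c -> y \in L u -> y \notin L c ->
    z \in L c -> g x z = g y z.
  by move=> *; rewrite !colA.
(* The module hypothesis passes to [c]: a leaf not below [c] either branches off at [u], where
   [colA] applies, or is not below [u]. *)
have modc x y z : x \in L c -> x \notin L h -> y \in L c -> y \notin L h ->
     z \notin L c -> g x z = g y z.
  move=> xc xh yc yh zc; have [zu|nzu] := boolP (z \in L u).
    by rewrite ![g _ z]gs !colA.
  by apply: mod => //; apply: (leaves_below_child uc).
have [a [ua La ah ca]] := IH c ep hE ec modc.
have [x0 x0d] := leaf_belowT d.
have x0u := leaves_below_child ud x0d.
have x0c : x0 \notin L c.
  by apply/negP => x0c; have := dis d x0 ud ndc x0c; rewrite x0d.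
(* The leaves branching off at [u] agree towards [L c] by the colour of [u] and towards the rest by
   [mod], so they form a module. *)
have eA : L u :\: L c = [set x0].
  apply: (primitive_module1 pr); rewrite ?in_setD ?x0u ?x0c //.
    move=> x y z; rewrite !in_setD negb_and negbK.
    case/andP => xc xu /andP [yc yu] /orP [zc|zu]; first exact: modA.
    by apply: mod => //; [apply: contra xc|apply: contra yc]; apply: hc.
  have [y yc] := leaf_belowT c; apply/eqP => e.
  by have := in_setT y; rewrite -e in_setD yc.
exists (x0 :: a); split.
- by rewrite /= ua andbT; apply: contra x0c; rewrite La orbC => ->.
- move=> x; rewrite in_cons orbCA -La; apply/idP/orP => [xu|[/eqP -> //|]].
    have [xc|nxc] := boolP (x \in L c); [by right|left].
    by rewrite -in_set1 -eA in_setD xu nxc.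
  exact: (leaves_below_child uc).
- move=> x; rewrite in_cons => /orP [/eqP ->|/ah //].
  by apply: contra x0c; apply: hc.
split=> //; exists (is_one (t u)) => y yy; apply: colA => //.
by rewrite La orbC.
Qed.

Lemma level1_two_caterps : two_caterps g.
Proof.
have allrho : [forall x, phi x \in [pred y | connect E rho y]].
  by apply/forallP => x; rewrite inE (root_above net).
have [w /forallP wall wlow] := acyclic_lowest
  (P := fun m => [forall x, phi x \in [pred y | connect E m y]]) acE allrho.
have wL x : x \in L w by have := wall x; rewrite !inE.
have properL c : E w c -> exists z, z \notin L c.
  move=> wc; have [|] := boolP [forall x, phi x \in [pred y | connect E c y]].
    by move=> /wlow /(_ (connect1 wc)) e; have := acyclic_irr w acE; rewrite -{2}e wc.
  by rewrite negb_forall => /existsP [z zc]; exists z; move: zc; rewrite !inE.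
have child (x z : T) : x != z -> exists c, E w c.
  move=> nxz; have [y nwy] : exists y, w != phi y.
    have [e|] := eqVneq w (phi x); last by exists x.
    by exists z; rewrite e; apply: contra nxz => /eqP /phi_inj ->.
  have := wL y; rewrite inE => wy.
  by have [c wc _] := connect_edge wy nwy; exists c.
have [c wc] : exists c, E w c.
  have [x0 _] := leaf_belowT w.
  have c1 : 0 < #|[set~ x0]|.
    by rewrite cardsC1; have := proj1 pr; case: #|T| => [|[]].
  by have [z] := card_gt0P c1; rewrite !inE => nz; apply: (child z x0).
have [/existsP [d /and3P [wd ncd /existsP [z0 /andP []]]]|nov] :=
    boolP [exists d, [&& E w d, c != d & [exists z, (z \in L c) && (z \in L d)]]];
  last first.
  (* If no other child shares a leaf with [c], all edges leaving [L c] have the colour of [w],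
     against primitivity. *)
  have [x0 x0c] := leaf_belowT c; have [z0 z0c] := properL c wc.
  case: (primitive_bipartition gs pr x0c z0c (c := is_one (t w))) => x z xc zc.
  apply: color_branch => //; first by apply: contraTneq xc => ->.
  move=> e we xe; have [ee|ne] := eqVneq c e; first by rewrite -ee.
  apply: contra nov => ze; apply/existsP; exists e; rewrite we ne /=.
  by apply/existsP; exists x; rewrite xc xe.
rewrite !inE => cz0 dz0.
have [h [ec ed _]] := exit_of_merge net wc wd ncd cz0 dz0.
have common (a b : V) x : E w a -> E w b -> a != b -> exit E a h ->
    x \in L a -> x \in L b -> exit E b h /\ x \in L h.
  rewrite !inE => wa wb nab ea ax bx.
  have [h' [ea' eb' h'x]] := exit_of_merge net wa wb nab ax bx.
  by rewrite (exit_inj net l1 ea ea').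
have third e : E w e -> c != e -> d != e -> ~~ exit E e h.
  by move=> we ne1 ne2; apply: (exit_three_children net l1 wc wd we).
(* No third child can share a leaf with [c] or [d], since it would have the exit [h] too. So a leaf
   below neither would separate [L c :|: L d] from the rest. *)
have covers x : (x \in L c) || (x \in L d).
  apply: contraT; rewrite negb_or => /andP [xc xd]; exfalso.
  have [y0 y0c] := leaf_belowT c.
  have y0A : y0 \in L c :|: L d by rewrite inE y0c.
  have xA : x \notin L c :|: L d by rewrite inE negb_or xc.
  case: (primitive_bipartition gs pr y0A xA (c := is_one (t w))) => y z.
  rewrite !in_setU negb_or => yy /andP [zc zd].
  apply: color_branch => //.
    by apply: contraTneq yy => ->; rewrite negb_or zc.
  move=> e we ye; have [<- //|ne1] := eqVneq c e; have [<- //|ne2] := eqVneq d e.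
  have := third e we ne1 ne2; case/orP: yy => yy.
    by have [-> _] := common c e y wc we ne1 ec yy ye.
  by have [-> _] := common d e y wd we ne2 ed yy ye.
have cross a x z : E w a -> exit E a h -> x \in L a -> x \notin L h -> z \notin L a ->
    g x z = is_one (t w).
  move=> wa ea xa xh za; apply: color_branch => //.
    by apply: contraTneq xa => ->.
  move=> e we xe; have [<- //|ne] := eqVneq a e.
  by have [_] := common a e x wa we ne ea xa xe; rewrite (negbTE xh).
have [a [ua La ah ca]] : exists a, [/\ uniq a,
    (forall x, (x \in L c) = (x \in L h) || (x \in a)),
    (forall x, x \in a -> x \notin L h) & caterp g (L h) a].
  by apply: side_caterp => // x y z *; rewrite !(cross c).
have [b [ub Lb bh cb]] : exists a, [/\ uniq a,
    (forall x, (x \in L d) = (x \in L h) || (x \in a)),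
    (forall x, x \in a -> x \notin L h) & caterp g (L h) a].
  by apply: side_caterp => // x y z *; rewrite !(cross d).
have all x : [|| x \in L h, x \in a | x \in b].
  by have := covers x; rewrite La Lb; case: (x \in L h).
have [v vh] := leaf_belowT h.
(* Every list entry sees all of [L h] in one colour, so [L h] is a module. *)
have eH : L h = [set v].
  apply: (primitive_module1 pr) => //.
    move=> x y z xh yh zh; have := all z; rewrite (negbTE zh) /= => /orP [] zz.
      by have [k hk] := caterp_bottom ca zz; rewrite ![g _ z]gs !hk.
    by have [k hk] := caterp_bottom cb zz; rewrite ![g _ z]gs !hk.
  have [z zc] := properL c wc; apply/eqP => e.
  by move: zc; rewrite La e inE.
rewrite eH in La Lb ah bh ca cb all.
have disj x : x \in a -> x \notin b.
  move=> xa; apply/negP => xb.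
  have xc : x \in L c by rewrite La xa orbT.
  have xd : x \in L d by rewrite Lb xb orbT.
  have [_] := common c d x wc wd ncd ec xc xd.
  by rewrite eH (negbTE (ah x xa)).
exists v, a, b; split=> //.
- rewrite /= cat_uniq ua ub mem_cat negb_or /= !andbT; apply/andP; split; first (apply/andP; split).
  + by apply/negP => /ah; rewrite inE eqxx.
  + by apply/negP => /bh; rewrite inE eqxx.
  by apply/hasPn => x; apply: contraL => /disj.
- by move=> x; have := all x; rewrite in_cons mem_cat in_set1.
exists (is_one (t w)) => x y xa yb; apply: (cross c) => //.
- by rewrite La xa orbT.
- by rewrite eH ah.
by rewrite La negb_or bh //=; apply: contraL yb => /disj.
Qed.

End Level1.

Lemma level1_network_two_caterps (T : finType) (g : rel T) (V : finType) (E : rel V)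
    (X : {set V}) (t : V -> lab) (phi : T -> V) :
  symmetric g -> primitive g -> network E X -> level1 E ->
  explains_on g setT E X t phi -> two_caterps g.
Proof.
move=> gs pr net l1 ex.
have cV : 1 < #|V|.
  have inj : injective phi by move=> x y; apply: ex.1; rewrite inE.
  by apply: leq_trans (leq_card phi inj); case: pr; case: #|T| => [|[]].
have [rho pn] := network_proper net cV.
exact: level1_two_caterps pn l1 ex.
Qed.

(** * Alternation of the colours *)

(** The case [H = [set v]] of [caterp] with prescribed colours, starting with [c] and flipping at
    each entry. *)
Fixpoint alt_caterp (T : finType) (g : rel T) (v : T) (c : bool) (s : seq T) : Prop :=
  if s is x :: s' then
    (forall y, y \in v :: s' -> g x y = c) /\ alt_caterp g v (~~ c) s'
  else True.

(** Both lists start with the colour opposite to [t0], so colours alternate from the root of the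
    cycle down each side. *)
Definition two_alt_caterps (T : finType) (g : rel T) v a b t0 : Prop :=
  [/\ uniq (v :: a ++ b), (forall x : T, x \in v :: a ++ b), 0 < size a & 0 < size b] /\
  [/\ alt_caterp g v (~~ t0) a, alt_caterp g v (~~ t0) b &
    forall x y, x \in a -> y \in b -> g x y = t0].

(** Two consecutive entries of equal colour would form a module: [v] and the later entries see them
    alike, and the last hypothesis handles all other vertices, including the entries already passed
    in the induction. *)
Lemma caterp_alt (T : finType) (g : rel T) v c x s :
  symmetric g -> primitive g -> uniq (v :: x :: s) -> caterp g [set v] (x :: s) ->
  (forall y, y \in v :: s -> g x y = c) ->
  (forall y1 y2 z, y1 \in x :: s -> y2 \in x :: s -> z \notin v :: x :: s ->
    g y1 z = g y2 z) ->
  alt_caterp g v c (x :: s).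
Proof.
move=> gs pr; elim: s x c => [//|x' s IH] x c un ca hc out.
split=> //; case: ca => [_ ca].
have [[k hk] _] := ca.
have hk' y : y \in v :: s -> g x' y = k.
  by move=> yy; apply: hk; move: yy; rewrite !inE orbC.
move: un; rewrite /= !inE !negb_or => /andP [/and3P [vx vx' vs] /and3P [/andP [xx' xs] x's us]].
have nk : k = ~~ c.
  have [kc|] := eqVneq k c; last by case: (k); case: (c).
  have m : module g [set x; x'].
    have aux z : z \notin [set x; x'] -> g x z = g x' z.
      rewrite !inE negb_or => /andP [zx zx'].
      have [zs|zs] := boolP (z \in v :: s).
        rewrite hk' // kc; apply: hc; move: zs; rewrite !inE; case/orP => ->; by rewrite ?orbT.
      apply: out; rewrite ?inE ?eqxx ?orbT //.
      by move: zs; rewrite !inE !negb_or zx zx' /= .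
    move=> y1 y2 z; rewrite !inE => /orP [] /eqP -> /orP [] /eqP -> // zz;
      by rewrite aux // !inE.
  have vn : v \notin [set x; x'] by rewrite !inE negb_or vx vx'.
  have nT : [set x; x'] != setT by apply: contraNneq vn => ->; rewrite inE.
  have := set22 x x'; rewrite (primitive_module1 pr m (set21 x x') nT) inE.
  by rewrite eq_sym (negbTE xx').
rewrite -nk; apply: IH => //.
- by rewrite /= inE negb_or vx' vs x's us.
move=> y1 y2 z h1 h2 hz; have [zx|nzx] := eqVneq z x.
  by rewrite zx ![g _ x]gs !hc // in_cons ?h1 ?h2 orbT.
apply: out; rewrite ?[_ \in x :: _]in_cons ?h1 ?h2 ?orbT //.
by move: hz; rewrite !inE !negb_or nzx.
Qed.

(** If the top colour were [t0], the entry [x] would see all other vertices in one colour. *)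
Lemma caterp_half (T : finType) (g : rel T) v t0 x (s b : seq T) :
  symmetric g -> primitive g -> uniq (v :: x :: s) ->
  (forall y, y \notin v :: x :: s -> y \in b) -> caterp g [set v] (x :: s) ->
  (forall y z, y \in x :: s -> z \in b -> g y z = t0) ->
  alt_caterp g v (~~ t0) (x :: s).
Proof.
move=> gs pr un cov ca cr.
have [[c hc] _] := ca.
have hc' y : y \in v :: s -> g x y = c.
  by move=> yy; apply: hc; move: yy; rewrite !inE orbC.
have vx : v != x by move: un; rewrite /= inE negb_or => /andP [/andP [->]].
have nc : c = ~~ t0.
  have [ct|] := eqVneq c t0; last by case: (c); case: (t0).
  case: (primitive_bipartition gs pr (A := [set x]) (x := x) (z := v) (c := c)).
  - by rewrite inE.
  - by rewrite inE.
  move=> y z; rewrite !inE => /eqP -> nzx.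
  have [zs|nzs] := boolP (z \in v :: s); first exact: hc'.
  rewrite ct; apply: cr; first by rewrite inE eqxx.
  by apply: cov; move: nzs; rewrite !inE !negb_or nzx.
rewrite -nc; apply: caterp_alt => // y1 y2 z h1 h2 /cov zb.
by rewrite !cr.
Qed.

Lemma two_caterps_alt (T : finType) (g : rel T) :
  symmetric g -> primitive g -> two_caterps g ->
  exists v a b t0, two_alt_caterps g v a b t0.
Proof.
move=> gs pr [v [a [b [un cov ca cb [t0 cr]]]]].
have half x s b' t : uniq (v :: x :: s) -> (forall y, y \in v :: (x :: s) ++ b') ->
    caterp g [set v] (x :: s) ->
    (forall y z, y \in x :: s -> z \in b' -> g y z = t) -> alt_caterp g v (~~ t) (x :: s).
  move=> us cv; apply: caterp_half => // y nv.
  by have : y \in (v :: x :: s) ++ b' := cv y; rewrite mem_cat (negbTE nv).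
(* With the other list empty, the cross condition holds vacuously for both values of [t0], and the
   first entry would see [v] in both colours. *)
have nonempty s : uniq (v :: s) -> (forall y, y \in v :: s) -> caterp g [set v] s -> False.
  case: s => [|x s] us cv cs.
    have : #|T| <= 1.
      by rewrite -(card1 v); apply/subset_leq_card/subsetP => y _; have := cv y; rewrite !inE.
    by case: pr; case: #|T| => [|[]].
  have cv' y : y \in v :: (x :: s) ++ [::] by rewrite cats0.
  have novac t y z : y \in x :: s -> z \in [::] -> g y z = t by [].
  have [h1 _] := half x s [::] true us cv' cs (novac _).
  have [h2 _] := half x s [::] false us cv' cs (novac _).
  by have := h1 v; rewrite h2 ?inE ?eqxx // => /(_ isT).
have cov' y : y \in v :: b ++ a by have := cov y; rewrite !inE !mem_cat [(y \in a) || _]orbC.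
move: (un); rewrite /= mem_cat negb_or cat_uniq => /andP [/andP [va vb] /and3P [ua _ ub]].
have sa : 0 < size a.
  case: a un cov ca cr cov' va ua => //= un cov ca cr _ _ _.
  by case: (nonempty b) => //=; rewrite vb.
have sb : 0 < size b.
  case: b un cov cb cr cov' vb ub sa => //= un cov cb cr cov' _ _ _.
  by case: (nonempty a) => //=; rewrite va.
exists v, a, b, t0; split=> //; split=> //.
  case: a sa ca cr cov va ua {un cov'} => // x s _ ca cr cov va ua.
  by apply: (half _ _ b) => //; apply/andP.
case: b sb cb cr cov' vb ub {un cov} => // x s _ cb cr cov vb ub.
apply: (half _ _ a) => //; first exact/andP.
by move=> y z yb za; rewrite gs; apply: cr.
Qed.

(** In an induced path on four vertices each vertex has a neighbour and a non-neighbour on it, so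
    the top entry lies on none and can be removed from [W]. *)
Lemma alt_caterp_cograph (T : finType) (g : rel T) v c s (W : {set T}) :
  symmetric g -> alt_caterp g v c s ->
  (forall x, x \in W -> x \in v :: s) -> cograph_on g W.
Proof.
move=> gs; elim: s c W => [|x s IH] c W /=.
  move=> _ h [p [q [r [u [[pW qW rW uW] [un _]]]]]].
  have := h p pW; have := h q qW; rewrite !inE => /eqP eq /eqP ep.
  by move: un; rewrite ep eq /= !inE eqxx.
move=> [hc alt] h P4.
have [P4' |] := boolP (x \in W); last first.
  move=> xW; apply: (IH (~~ c) W alt) => // y yW; have := h y yW; rewrite !inE.
  by case: (eqVneq y x) => [e|]; [rewrite e (negbTE xW) in yW|rewrite orbCA].
apply: (IH (~~ c) (W :\ x) alt).
  move=> y; rewrite !inE => /andP [nyx yW]; have := h y yW; rewrite !inE (negbTE nyx).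
  by [].
case: P4 => [p [q [r [u [[pW qW rW uW] [un [[g1 g2 g3] [n1 n2 n3]]]]]]]].
have hx y : y \in W -> y != x -> g x y = c.
  by move=> /h; rewrite !inE => yy ne; apply: hc; move: yy; rewrite !inE (negbTE ne).
exists p, q, r, u; split=> //; move: un; rewrite /= !inE !negb_or.
case/and4P => /and3P [pq pr pu] /andP [qr qu] ru _.
have [e1 e2 e3 e4] : [/\ p != x, q != x, r != x & u != x].
  split; apply/eqP => e; move: hx; rewrite -e => hx.
  - by move: n1; rewrite (hx r) 1?eq_sym // -(hx q) 1?eq_sym // g1.
  - by move: n2; rewrite (hx u) 1?eq_sym // -(hx r) 1?eq_sym // g2.
  - by move: n1; rewrite gs (hx p) // -(hx q) // gs g2.
  - by move: n2; rewrite gs (hx q) // -(hx r) // gs g3.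
by split; rewrite ?e1 ?e2 ?e3 ?e4 ?pq ?pr ?pu ?qr ?qu ?ru.
Qed.

(** * Caterpillars of polar-cats *)

(** Induction down the spine [r :: s], where [r] need not be the root. Each spine vertex except the
    last has one spine child and one leaf child, the next list entry. The last one is the cherry's
    parent [p], which carries [v] and the final entry. *)
Lemma caterpillar_caterp (T V : finType) (g : rel T) (W : {set T}) (E : rel V)
    (X : {set V}) (rho : V) (t : V -> lab) (phi : T -> V) v p y s r :
  proper_network E X rho -> (forall v, indeg E v <= 1) ->
  explains_on g W E X t phi -> (forall v, v \notin X -> outdeg E v = 2) ->
  v \in W -> y \in X -> y != phi v -> E p (phi v) -> E p y ->
  path E r s -> uniq (r :: s) -> {in r :: s, forall u, u \notin X} ->
  (forall u c, u \in r :: s -> E u c -> c \notin X -> c \in s) -> p \in r :: s ->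
  exists a, [/\ uniq (v :: a),
    (forall x, (x \in W) && connect E r (phi x) = (x \in v :: a)) & caterp g [set v] a].
Proof.
move=> net i1 ex o2 vW yX nyv pv py.
have acE : acyclic E by case: net => [[]].
have two u c d e : u \notin X -> E u c -> E u d -> E u e -> c != d -> c != e -> d = e.
  move=> uX uc ud ue n1 n2; apply/eqP; apply: contraT => n3.
  by have := card_set_gt2 (P := E u) uc ud ue n1 n2 n3; rewrite -/(outdeg E u) o2.
have dis u c d z : E u c -> E u d -> c != d -> connect E c z -> ~~ connect E d z.
  move=> uc ud ncd cz; apply/negP => dz.
  have [h [/exitP [hh _ _] _ _]] := exit_of_merge net uc ud ncd cz dz.
  by have := i1 h; move/eqP: hh => ->.
have inX x : x \in W -> phi x \in X by move=> xW; rewrite ex.2.1 imset_f.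
have step u x : u \notin X -> x \in W -> connect E u (phi x) ->
    exists2 c, E u c & connect E c (phi x).
  by move=> uX xW ux; apply: connect_edge => //; apply: contraNneq uX => ->; apply: inX.
have leafE c x : c \in X -> x \in W -> connect E c (phi x) -> phi x = c.
  by move=> cX xW; apply: (leaf_connect net cX).
elim: s r => [|u s IH] r /=.
  move=> _ _ inn _; rewrite inE => /eqP e; rewrite {}e in pv py.
  have rX : r \notin X by apply: inn; rewrite inE.
  move: (yX) nyv py; rewrite ex.2.1 => /imsetP [y0 y0W ->] nyv py.
  have nvy : y0 != v by apply: contraNneq nyv => ->.
  exists [:: y0]; split; first by rewrite /= inE eq_sym nvy.
    move=> x; rewrite !inE; apply/andP/orP => [[xW rx]|[] /eqP ->]; last 2 first.
    - by split=> //; apply: connect1.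
    - by split=> //; apply: connect1.
    have [c rc cx] := step r x rX xW rx.
    have cs : c = phi v \/ c = phi y0.
      have [|nc] := eqVneq c (phi v); [by left|right].
      by rewrite (two r (phi v) c (phi y0)) 1?eq_sym.
    have cX : c \in X by case: cs => ->; apply: inX.
    have e := leafE c x cX xW cx; rewrite -{}e in cs.
    by case: cs => /ex.1 -> //; [left|right].
  split=> //; exists (g y0 v) => z; rewrite !inE /= => /eqP -> //.
case/andP => ru ep /andP [nr us] inn cl pin.
have rX : r \notin X by apply: inn; rewrite inE eqxx.
have uX : u \notin X by apply: inn; rewrite !inE eqxx orbT.
(* Otherwise [r] would have three children: the inner vertex [u] and the two cherry leaves. *)
have npr : p != r.
  apply: contraNneq nyv => e; rewrite {}e in pv py.
  by rewrite (two r u y (phi v)) //; apply: contraNneq uX => ->; rewrite ?inX.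
have o1 : 1 < #|[set c | E r c]| by rewrite -/(outdeg E r) o2.
have [d rd ndu] : exists2 d, E r d & d != u.
  have : ~~ ([set c | E r c] \subset [set u]).
    by apply/negP => /subset_leq_card; rewrite cards1 leqNgt o1.
  by case/subsetPn => d; rewrite !inE => rd nd; exists d.
have nud : u != d by rewrite eq_sym.
(* An inner [d] would be a spine vertex below [u], hence below two children of [r], which is
   impossible in a tree. *)
have dX : d \in X.
  apply: contraT => /(cl r d (mem_head _ _) rd) ds.
  by have := dis r u d d ru rd nud (path_connect ep ds); rewrite connect0.
have [a [ua La ca]] : exists a, [/\ uniq (v :: a),
    (forall x, (x \in W) && connect E u (phi x) = (x \in v :: a)) & caterp g [set v] a].
  apply: IH => //.
  - by move=> z zz; apply: inn; rewrite inE zz orbT.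
  - move=> z c zz zc cX.
    have : c \in u :: s by apply: (cl z) => //; rewrite inE zz orbT.
    rewrite inE => /orP [/eqP e|//]; rewrite {}e in zc.
    have nzr : z != r by apply: contraNneq nr => <-.
    have := card_set_gt1 (P := fun q => E q u) zc ru nzr.
    by rewrite -/(indeg E u) ltnNge i1.
  by move: pin; rewrite inE (negbTE npr).
move: (dX); rewrite ex.2.1 => /imsetP [x0 x0W dE]; rewrite {}dE in rd ndu nud dX.
have x0u : ~~ connect E u (phi x0) by apply: (dis r (phi x0)) => //; rewrite connect0.
have x0a : x0 \notin v :: a by rewrite -La x0W.
have child c : E r c -> c = u \/ c = phi x0.
  have [|nc] := eqVneq c u; [by left|right].
  by rewrite (two r u c (phi x0)) 1?eq_sym.
exists (x0 :: a); split.
- by move: x0a ua; rewrite /= !inE !negb_or eq_sym => /andP [-> ->].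
- move=> x; rewrite inE [x \in x0 :: a]inE orbCA -in_cons -La.
  apply/andP/orP => [[xW rx]|[/eqP ->|/andP [xW ux]]].
  + have [c rc cx] := step r x rX xW rx.
    case: (child c rc) => e; rewrite {}e in cx; first by right; rewrite xW.
    by left; apply/eqP/ex.1 => //; apply: leafE.
  + by split=> //; apply: connect1.
  by split=> //; apply: connect_trans ux; apply: connect1.
split=> //; exists (is_one (t r)) => z zz.
have zva : z \in v :: a by move: zz; rewrite !inE orbC.
have /andP [zW uz] : (z \in W) && connect E u (phi z) by rewrite La.
apply: (explains_color ex) => //; first by apply: contraNneq x0a => ->.
apply: branch_lca => //; [exact: connect1|by apply: connect_trans uz; apply: connect1|].
move=> c rc cx0; case: (child c rc) => e; first by rewrite e (negbTE x0u) in cx0.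
by rewrite e; apply: (dis r u).
Qed.

Lemma cat_with_cherry_caterp (T : finType) (g : rel T) (W : {set T}) v :
  cat_with_cherry g W v -> v \in W ->
  exists a, [/\ uniq (v :: a), (forall x, (x \in W) = (x \in v :: a)) & caterp g [set v] a].
Proof.
case=> V [E [X [t [phi [[rt _ _ ex] [cat cher]]]]]].
case: rt => net i1; case: cat => o2 [r [s [r0 ep us inn]]].
case: cher => _ [y [p [yX nyv pv py]]].
move=> vW.
have rX : r \notin X by rewrite inn mem_head.
have [rho pn] : exists rho, proper_network E X rho.
  apply: network_proper net _; apply: (@leq_trans #|[set y; phi v]|).
    by rewrite cards2 nyv.
  exact: max_card.
have er : r = rho by case: pn => [[_ _ _ h] _]; apply: h.
have pX : p \notin X by apply: leaf_no_child pn _ _ pv.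
have [a [ua La ca]] : exists a, [/\ uniq (v :: a),
    (forall x, (x \in W) && connect E r (phi x) = (x \in v :: a)) & caterp g [set v] a].
  apply: (caterpillar_caterp pn i1 ex o2 vW yX nyv pv py ep us).
  - by move=> u /inn.
  - move=> u c _ uc /inn; rewrite inE => /orP [/eqP e|//].
    by have := indeg_gt0 uc; rewrite e r0.
  exact/inn.
exists a; split=> // x; by rewrite -La er (root_above pn) andbT.
Qed.

Lemma polar_cat_two_caterps (T : finType) (g : rel T) :
  polar_cat g -> two_caterps g.
Proof.
case=> v [W1 [W2 [[[cov cap _ _] [_ [_ part]]] [_ [_ [c1 c2]]]]]].
have /andP [v1 v2] : (v \in W1) && (v \in W2) by rewrite -in_setI cap inE.
have [a [ua La ca]] := cat_with_cherry_caterp c1 v1.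
have [b [ub Lb cb]] := cat_with_cherry_caterp c2 v2.
move: (ua) (ub) => /= /andP [va ua'] /andP [vb ub'].
have dj x : x \in a -> x \notin b.
  move=> xa; apply/negP => xb; have : x \in W1 :&: W2.
    by rewrite inE La Lb !inE xa xb !orbT.
  by rewrite cap inE => /eqP e; rewrite -e xa in va.
exists v, a, b; split=> //.
- rewrite /= mem_cat negb_or va vb cat_uniq ua' ub' /= andbT.
  by apply/hasPn => x; apply: contraL => /dj.
- move=> x; have := in_setT x; rewrite -cov in_setU La Lb !in_cons mem_cat.
  by case: (x == v).
have sd x : x \in a -> x \in W1 :\ v.
  by move=> xa; rewrite in_setD1 La in_cons xa orbT andbT; apply: contraNneq va => <-.
have sd2 x : x \in b -> x \in W2 :\ v.
  by move=> xb; rewrite in_setD1 Lb in_cons xb orbT andbT; apply: contraNneq vb => <-.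
case: part => h; [exists true|exists false] => x y /sd xa /sd2 yb.
  exact: h.
exact: negbTE (h x y xa yb).
Qed.

(** * Construction of the caterpillars *)

Lemma card_ord_eq0 n (P : nat -> bool) :
  (forall i, i < n -> ~~ P i) -> #|[set i : 'I_n | P i]| = 0.
Proof.
move=> h; apply: eq_card0 => i; rewrite inE; apply/negP => Pi.
by have := h i (ltn_ord i); rewrite Pi.
Qed.

Lemma card_ord_eq1 n (P : nat -> bool) k :
  k < n -> (forall i, i < n -> P i = (i == k)) -> #|[set i : 'I_n | P i]| = 1.
Proof.
move=> kn h; apply/eqP/cards1P; exists (Ordinal kn); apply/setP => i.
by rewrite !inE h // -val_eqE.
Qed.

Lemma card_ord_eq2 n (P : nat -> bool) k l :
  k < n -> l < n -> k != l -> (forall i, i < n -> P i = (i == k) || (i == l)) ->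
  #|[set i : 'I_n | P i]| = 2.
Proof.
move=> kn ln nkl h.
have -> : [set i : 'I_n | P i] = [set Ordinal kn; Ordinal ln]; last first.
  by rewrite cards2 -val_eqE /= nkl.
by apply/setP => i; rewrite !inE h // -!val_eqE.
Qed.

Lemma acyclic_rank (V : finType) (E : rel V) (f : V -> nat) :
  (forall u v, E u v -> f u < f v) -> acyclic E.
Proof.
move=> h u v uv; apply/negP => /connectP [p ep e].
have : f v <= f u.
  rewrite {}e {uv}; elim: p v ep => //= w p IH v /andP [/h vw /IH].
  by apply: leq_trans; apply: ltnW.
by rewrite leqNgt h.
Qed.

(** Applied with arithmetic conditions as [R], this bounds reachability in the concrete networks
    from above. *)
Lemma connect_rel (V : finType) (E : rel V) (R : V -> V -> Prop) u w :
  (forall u, R u u) -> (forall u v w, E u v -> R v w -> R u w) ->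
  connect E u w -> R u w.
Proof.
move=> R0 RS /connectP [p]; elim: p u => [|v p IH] u /=; first by move=> _ ->.
by case/andP => uv ep e; apply: RS uv (IH v ep e).
Qed.

(** Appending [v] gives it the last index, so it is treated like an entry; the colour is the parity
    of the smaller index. *)
Lemma alt_caterp_index (T : finType) (g : rel T) v c a x y :
  alt_caterp g v c a -> uniq (v :: a) -> y \in v :: a ->
  index x (rcons a v) < index y (rcons a v) ->
  g x y = c (+) odd (index x (rcons a v)).
Proof.
elim: a c => [|z a IH] c /=.
  by move=> _ _; rewrite !inE => /eqP ->; rewrite eqxx ltn0.
move=> [hz alt] un; rewrite !inE => yy; move: un; rewrite !inE !negb_or.
case/andP=> /andP [vz va] /andP [za ua].
have [<-|nzx] := eqVneq z x.
  have [e|nzy] := eqVneq z y; first by rewrite ltnn.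
  move=> _; rewrite addbF; apply: hz; move: yy; rewrite inE [y == z]eq_sym (negbTE nzy).
  by [].
have [e|nzy] := eqVneq z y; first by rewrite ltn0.
rewrite ltnS => lt; rewrite (IH (~~ c)) //=; first by rewrite addNb addbN.
  by rewrite va.
by move: yy; rewrite inE [y == z]eq_sym (negbTE nzy).
Qed.

Section Caterpillar.

Variable p : nat.
Hypothesis p0 : 0 < p.

(* Inner vertices [0 .. p-1] from the top down; the leaf at [i] is [p + i], and
   the last inner vertex carries the second leaf [2 p]. *)
Definition cat_edge (i j : nat) : bool :=
  (i < p) && [|| (j == i.+1) && (j < p), j == p + i | (i.+1 == p) && (j == p + p)].

Local Notation N := (p + p).+1.
Let E : rel 'I_N := fun i j => cat_edge i j.
Let X : {set 'I_N} := [set i : 'I_N | p <= i].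
Let o (i : nat) : 'I_N := inord i.

Let oK i : i <= p + p -> o i = i :> nat.
Proof. by move=> h; rewrite inordK. Qed.

Lemma cat_edge_lt i j : cat_edge i j -> i < j.
Proof. by rewrite /cat_edge; lia. Qed.

Lemma cat_acyclic : acyclic E.
Proof. by apply: (@acyclic_rank _ _ (@nat_of_ord N)) => u v; apply: cat_edge_lt. Qed.

Lemma cat_indeg (j : 'I_N) : indeg E j = (0 < j).
Proof.
have lj := ltn_ord j; rewrite /indeg /E; case: posnP => [j0|jp].
  by apply: (@card_ord_eq0 _ (fun i => cat_edge i j)) => i _; rewrite /cat_edge; lia.
have pick k : k < N -> (forall i, i < N -> cat_edge i j = (i == k)) ->
    #|[set i : 'I_N | cat_edge i j]| = 1.
  exact: (@card_ord_eq1 _ (fun i => cat_edge i j)).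
have [lt|ge] := ltnP j p.
  by apply: (pick j.-1) => [|i li]; rewrite /cat_edge; lia.
have [e|ne] := eqVneq (j : nat) (p + p).
  by apply: (pick p.-1) => [|i li]; rewrite /cat_edge; lia.
by apply: (pick (j - p)) => [|i li]; rewrite /cat_edge; lia.
Qed.

Lemma cat_outdeg (i : 'I_N) : outdeg E i = if i < p then 2 else 0.
Proof.
have li := ltn_ord i; rewrite /outdeg /E; case: ltnP => ip.
  have pick k : k < N -> p + i != k ->
      (forall j, j < N -> cat_edge i j = (j == p + i) || (j == k)) ->
      #|[set j : 'I_N | cat_edge i j]| = 2.
    by apply: (@card_ord_eq2 _ (cat_edge i)); lia.
  have [lt|ge] := ltnP i.+1 p.
    by apply: (pick i.+1) => [||j lj]; rewrite /cat_edge; lia.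
  by apply: (pick (p + p)) => [||j lj]; rewrite /cat_edge; lia.
by apply: (@card_ord_eq0 _ (cat_edge i)) => j _; rewrite /cat_edge; lia.
Qed.

Lemma cat_rooted_tree : rooted_tree E X.
Proof.
split; last by move=> v; rewrite cat_indeg; case: (0 < v).
split; first exact: cat_acyclic.
right; exists (o 0); split; [|split].
- split.
  + by rewrite cat_indeg oK.
  + by rewrite cat_outdeg oK // p0.
  by move=> u; rewrite cat_indeg => u0; apply: val_inj; rewrite /= oK //; lia.
- move=> x; rewrite inE cat_outdeg cat_indeg; split.
    by move=> px; rewrite ltnNge px /=; lia.
  by case: ltnP => // ? [].
move=> v; rewrite inE -ltnNge => vp nv; left; rewrite cat_indeg cat_outdeg vp; split=> //.
have v0 : v <> 0 :> nat by move=> e; apply: nv; apply: val_inj; rewrite /= oK.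
by rewrite lt0n; case: eqP.
Qed.

Lemma cat_caterpillar : caterpillar E X.
Proof.
split; first by move=> v; rewrite inE -ltnNge cat_outdeg => ->.
have rs : o 0 :: map o (iota 1 p.-1) = map o (iota 0 p) by rewrite -[X in iota 0 X](prednK p0).
exists (o 0), (map o (iota 1 p.-1)); rewrite rs; split.
- by rewrite cat_indeg oK.
- apply/(pathP (o 0)) => i; rewrite size_map size_iota => ip; rewrite rs.
  rewrite !(nth_map 0) ?size_iota ?nth_iota //; try lia.
  by rewrite /E !oK /cat_edge; lia.
- rewrite map_inj_in_uniq ?iota_uniq // => i j; rewrite !mem_iota => hi hj e.
  by have := congr1 (@nat_of_ord _) e; rewrite !oK; lia.
move=> v; rewrite inE -ltnNge; split=> [vp|/mapP [i]].
  by apply/mapP; exists (nat_of_ord v); rewrite ?mem_iota //= /o inord_val.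
by rewrite mem_iota => ip ->; rewrite oK; lia.
Qed.

Lemma cat_connect_anc (i j : 'I_N) : connect E i j ->
  i = j \/ i < p /\ (i <= j < p \/ p + i <= j).
Proof.
apply: (@connect_rel _ _ (fun i j : 'I_N => i = j \/ i < p /\ (i <= j < p \/ p + i <= j))).
  by left.
move=> u v w; rewrite /E /cat_edge => uv [<-|]; lia.
Qed.

Lemma cat_connect_inner i j : i <= j -> j < p -> connect E (o i) (o j).
Proof.
elim: j => [|j IH] ij jp; first by have -> : i = 0 by lia.
have [->|n] := eqVneq i j.+1; first exact: connect0.
apply: connect_trans (IH _ _) (connect1 _); try lia.
by rewrite /E !oK /cat_edge; lia.
Qed.

Lemma cat_connect_leaf i k : i < p -> i <= k -> k <= p -> connect E (o i) (o (p + k)).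
Proof.
move=> ip ik kp; have [->|n] := eqVneq k p.
  apply: connect_trans (@cat_connect_inner i p.-1 _ _) (connect1 _); try lia.
  by rewrite /E !oK /cat_edge; lia.
apply: connect_trans (@cat_connect_inner i k _ _) (connect1 _); try lia.
by rewrite /E !oK /cat_edge; lia.
Qed.

(** The inner ancestors of the leaf [p + k] are the inner vertices up to [k], so the smaller index
    decides. *)
Lemma cat_lca i j w : i < j -> j <= p -> is_lca E (o (p + i)) (o (p + j)) w -> w = i :> nat.
Proof.
move=> ij jp /and3P [wi wj /forallP h].
have [e1|[wp /= e1]] := cat_connect_anc wi; have [e2|[wp' /= e2]] := cat_connect_anc wj.
- by have := congr1 (@nat_of_ord _) e1; rewrite e2 !oK; lia.
- by move: wp'; rewrite e1 oK; lia.
- by move: wp; rewrite e2 oK; lia.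
move: e1 e2; rewrite !oK; try lia; move=> e1 e2.
have := h (o i); rewrite /anc cat_connect_leaf ?cat_connect_leaf //=; try lia.
have -> : w = o w by rewrite /o inord_val.
rewrite cat_connect_inner //=; try lia.
by move=> /eqP <-; rewrite oK; lia.
Qed.

End Caterpillar.

Lemma alt_caterp_cat_with_cherry (T : finType) (g : rel T) v c a :
  symmetric g -> uniq (v :: a) -> 0 < size a -> alt_caterp g v c a ->
  cat_with_cherry g [set x in v :: a] v.
Proof.
move=> gs un; move pE: (size a) => p p0 alt.
set s := rcons a v.
have ss : size s = p.+1 by rewrite size_rcons pE.
have ms x : (x \in [set x in v :: a]) = (x \in s) by rewrite inE mem_rcons.
have us : uniq s by rewrite rcons_uniq.
pose t (i : 'I_(p + p).+1) : lab :=
  if p <= i then Ldot else if c (+) odd i then L1 else L0.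
(* The entry of index [i] becomes the leaf at inner vertex [i]; [v], of index [p], becomes the
   second leaf [2 p] of the last inner vertex, hence part of the cherry. *)
pose phi (x : T) : 'I_(p + p).+1 := inord (p + index x s).
have idx x : x \in s -> index x s <= p by rewrite -index_mem ss.
have phiE x : x \in s -> phi x = p + index x s :> nat.
  by move=> /idx h; rewrite inordK; lia.
exists 'I_(p + p).+1, (fun i j : 'I_(p + p).+1 => cat_edge p i j), [set i : 'I_(p + p).+1 | p <= i], t, phi.
split; [split|split].
- exact: (cat_rooted_tree p0).
- by move=> i; rewrite /t inE; case: leqP => // _; case: (_ (+) _).
- move=> i j ij; rewrite !inE -!ltnNge => ip jp; rewrite /t ![p <= _]leqNgt ip jp /=.
  have -> : j = i.+1 :> nat by move: ij; rewrite /cat_edge; lia.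
  by rewrite oddS addbN; case: (_ (+) _).
- split; [|split].
  + move=> x y; rewrite !ms => xs ys e; have := congr1 (@nat_of_ord _) e.
    rewrite !phiE // => /addnI e'.
    by rewrite -(nth_index v xs) e' nth_index.
  + apply/setP => i; rewrite inE; apply/idP/imsetP => [pi|[x]].
      have li : i - p < size s by rewrite ss; have := ltn_ord i; lia.
      exists (nth v s (i - p)); first by rewrite ms mem_nth.
      by apply: val_inj; rewrite /= phiE ?mem_nth // index_uniq //; lia.
    by rewrite ms => xs ->; rewrite phiE //; lia.
  have main x y w : x \in s -> y \in s -> index x s < index y s ->
      is_lca (fun i j : 'I_(p + p).+1 => cat_edge p i j) (phi x) (phi y) w ->
      (g x y <-> t w = L1).
    move=> xs ys lt lw; have ly := idx y ys.
    have e := cat_lca p0 lt ly lw.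
    rewrite (alt_caterp_index alt un _ lt); last by rewrite -mem_rcons.
    by rewrite /t e leqNgt (leq_trans lt ly) /=; case: (_ (+) _).
  move=> x y; rewrite !ms => xs ys nxy w lw.
  have nidx : index x s != index y s.
    by apply: contra nxy => /eqP e; rewrite -(nth_index v xs) e nth_index.
  have [lt|lt|e] := ltngtP (index x s) (index y s); last by rewrite e eqxx in nidx.
    exact: main.
  rewrite gs; apply: main => //; case/and3P: lw => w1 w2 /forallP w3.
  apply/and3P; split=> //; apply/forallP => m; have := w3 m.
  by rewrite [anc _ m _ && anc _ m (phi y)]andbC.
- exact: (cat_caterpillar p0).
have vs : v \in s by rewrite mem_rcons mem_head.
have iv : index v s = p.
  rewrite /s -cats1 index_cat; move: un => /= /andP [/negbTE -> _].
  by rewrite /= eqxx addn0.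
split; first by rewrite inE phiE // iv leq_addl.
exists (inord (p + p.-1)), (inord p.-1); split.
- by rewrite inE inordK; lia.
- by rewrite -val_eqE /= phiE // iv inordK; lia.
- by rewrite /cat_edge phiE // iv inordK; lia.
by rewrite /cat_edge !inordK; lia.
Qed.

(** * Construction of the elementary network *)

(** Once [c] is deleted, or if it is not in [B], nothing connects [l] to a third vertex of [B]. *)
Lemma biconn_no_pendant (V : finType) (r : rel V) (B : {set V}) l c :
  biconn r B -> 2 < #|B| -> l != c -> (forall z, r l z -> z = c) -> l \notin B.
Proof.
move=> [_ [cB dB]] B3 nlc lc; apply/negP => lB.
have [z] : exists z, z \in B :\ l :\ c.
  apply/card_gt0P; have := cardsD1 l B; have := cardsD1 c (B :\ l).
  by rewrite lB; case: (c \in _) => /= ->; lia.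
rewrite !in_setD1 => /and3P [zc zl zB]; rewrite eq_sym in zl.
have [cinB|ncB] := boolP (c \in B).
  have lD : l \in B :\ c by rewrite in_setD1 nlc.
  have zD : z \in B :\ c by rewrite in_setD1 zc.
  have [y] := connect_edge (dB c cinB l z lD zD) zl.
  by rewrite restrE !in_setD1 => /and3P [_ /andP [yc _] /lc e]; rewrite e eqxx in yc.
have [y] := connect_edge (cB l z lB zB) zl.
by rewrite restrE => /and3P [_ yB /lc e]; rewrite -e yB in ncB.
Qed.

Lemma card_ord_lt n k : k <= n -> #|[set i : 'I_n | i < k]| = k.
Proof.
move=> kn; rewrite -[RHS]card_ord -(@card_imset _ _ (widen_ord kn)); last first.
  by move=> i j e; apply: val_inj; have := congr1 (@nat_of_ord n) e.
apply: eq_card => i; rewrite inE; apply/idP/imsetP => [ik|[j _ ->] /=].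
  by exists (Ordinal ik) => //; apply: val_inj.
exact: ltn_ord.
Qed.

Lemma path_iota (e : rel nat) i k :
  (forall j, i <= j < i + k -> e j j.+1) -> path e i (iota i.+1 k).
Proof.
elim: k i => //= k IH i h; rewrite h /=; last by lia.
by apply: IH => j hj; apply: h; lia.
Qed.

Lemma last_iota x i k : last x (iota i k.+1) = i + k.
Proof. by rewrite -addn1 iotaD last_cat. Qed.

Section Cycle.

Variables p q : nat.
Hypothesis p0 : 0 < p.
Hypothesis q0 : 0 < q.

Local Notation m := (p + q).+1.
Local Notation N := (m + m).+1.

(* The cycle is [0 .. m]: the root [0], one side [1 .. p], the hybrid [p + 1] and
   the other side [p + 2 .. m]. The leaf at [i > 0] is [m + i]. *)
Definition net_edge (i j : nat) : bool :=
  (i <= m) && [|| (0 < i) && (j == m + i), (i <= p) && (j == i.+1),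
    (i == 0) && (j == p.+2), [&& p.+1 < i, i < m & j == i.+1] |
    (i == m) && (j == p.+1)].

Definition net_rel : rel 'I_N := fun i j => net_edge i j.

Definition net_leaves : {set 'I_N} := [set i : 'I_N | m < i].

(** Reachability on the cycle: the root is above everything, each side is ordered by number, and the
    second side is above the hybrid [p + 1]. *)
Definition cyc_anc (i k : nat) : bool :=
  [&& i <= m, k <= m & [|| i == 0, i <= k <= p.+1, p.+1 < i <= k | (p.+1 < i) && (k == p.+1)]].

Let E := net_rel.
Let X := net_leaves.
Let o (i : nat) : 'I_N := inord i.

Let oK i : i <= m + m -> o i = i :> nat.
Proof. by move=> h; rewrite inordK. Qed.

Let oE (i : 'I_N) : i = o i.
Proof. by rewrite /o inord_val. Qed.

Let EE (i j : 'I_N) : E i j = net_edge i j.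
Proof. by []. Qed.

Let oEE i j : i <= m + m -> j <= m + m -> E (o i) (o j) = net_edge i j.
Proof. by move=> h1 h2; rewrite EE !oK. Qed.

Lemma net_acyclic : acyclic E.
Proof.
(* Numbers increase along every edge except the one from [m] to [p + 1], so the hybrid is ranked
   after all other cycle vertices and just before the leaves. *)
apply: (@acyclic_rank _ _ (fun i : 'I_N =>
  if i == p.+1 :> nat then m.+1 else if i <= m then nat_of_ord i else m.+2)) => u v.
rewrite EE /net_edge => uv.
have [e|ne] := eqVneq (u : nat) p.+1; have [e'|ne'] := eqVneq (v : nat) p.+1;
  have [l|l] := leqP u m; have [l'|l'] := leqP v m; lia.
Qed.

Lemma net_indeg (j : 'I_N) :
  indeg E j = if j == 0 :> nat then 0 else if j == p.+1 :> nat then 2 else 1.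
Proof.
have lj := ltn_ord j; rewrite /indeg /E /net_rel.
have pick k : k < N -> (forall i, i < N -> net_edge i j = (i == k)) ->
    #|[set i : 'I_N | net_edge i j]| = 1.
  exact: (@card_ord_eq1 _ (fun i => net_edge i j)).
have [j0|jp] := eqVneq (j : nat) 0.
  by apply: (@card_ord_eq0 _ (fun i => net_edge i j)) => i _; rewrite /net_edge; lia.
have [e|ne] := eqVneq (j : nat) p.+1.
  apply: (@card_ord_eq2 _ (fun i => net_edge i j) p m) => [|||i li]; rewrite /net_edge; lia.
have [lt|ge] := ltnP m j.
  by apply: (pick (j - m)) => [|i li]; rewrite /net_edge; lia.
have [e|ne2] := eqVneq (j : nat) p.+2.
  by apply: (pick 0) => [|i li]; rewrite /net_edge; lia.
by apply: (pick j.-1) => [|i li]; rewrite /net_edge; lia.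
Qed.

Lemma net_outdeg (i : 'I_N) :
  outdeg E i = if m < i then 0 else if i == p.+1 :> nat then 1 else 2.
Proof.
have li := ltn_ord i; rewrite /outdeg /E /net_rel.
have pick k l : k < N -> l < N -> k != l ->
    (forall j, j < N -> net_edge i j = (j == k) || (j == l)) ->
    #|[set j : 'I_N | net_edge i j]| = 2.
  exact: (@card_ord_eq2 _ (net_edge i)).
have [lt|ge] := ltnP m i.
  by apply: (@card_ord_eq0 _ (net_edge i)) => j _; rewrite /net_edge; lia.
have [e|ne] := eqVneq (i : nat) p.+1.
  by apply: (@card_ord_eq1 _ (net_edge i) (m + i)) => [|j lj]; rewrite /net_edge; lia.
have [i0|i0] := eqVneq (i : nat) 0.
  by apply: (pick 1 p.+2) => [|||j lj]; rewrite /net_edge; lia.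
have [e|ne2] := eqVneq (i : nat) m.
  by apply: (pick (m + i) p.+1) => [|||j lj]; rewrite /net_edge; lia.
by apply: (pick (m + i) i.+1) => [|||j lj]; rewrite /net_edge; lia.
Qed.

Lemma net_network : network E X.
Proof.
split; first exact: net_acyclic.
right; exists (o 0); split; [|split].
- split; first by rewrite net_indeg oK.
    by rewrite net_outdeg oK.
  move=> u; rewrite net_indeg; case: eqP => [u0 _|]; last by case: eqP.
  by apply: val_inj; rewrite /= oK.
- move=> x; rewrite inE net_outdeg net_indeg; split.
    by move=> mx; rewrite mx !ifN //; lia.
  by case: ltnP => // _ []; case: eqP.
move=> v; rewrite inE -leqNgt => vm nv.
have v0 : (v : nat) != 0 by apply/eqP => e; apply: nv; apply: val_inj; rewrite /= oK.
have nm : (m < v) = false by rewrite ltnNge vm.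
rewrite net_indeg net_outdeg (negbTE v0) nm.
by case: eqP; [right|left].
Qed.

Lemma hybridE (w : 'I_N) : hybrid E w = (w == p.+1 :> nat).
Proof. by rewrite /hybrid net_indeg; have [->|_] := eqVneq (w : nat) 0; last by have [|] := eqVneq (w : nat) p.+1. Qed.

(** The last disjunct is for leaves: the leaf [j] hangs at the cycle vertex [j - m]. *)
Lemma net_connect_anc (i j : 'I_N) : connect E i j ->
  [|| i == j :> nat, cyc_anc i j | (m < j) && cyc_anc i (j - m)].
Proof.
apply: (@connect_rel _ _ (fun i j : 'I_N =>
  [|| i == j :> nat, cyc_anc i j | (m < j) && cyc_anc i (j - m)])) => [u|u v w].
  by rewrite eqxx.
have lv := ltn_ord v; have lw := ltn_ord w.
by rewrite EE /net_edge /cyc_anc; lia.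
Qed.

Lemma net_connect_range i k : i <= k <= p.+1 \/ p.+1 < i <= k /\ k <= m ->
  connect E (o i) (o k).
Proof.
elim: k => [|k IH] h; first by have -> : i = 0 by lia.
have [->|n] := eqVneq i k.+1; first exact: connect0.
apply: connect_trans (IH _) (connect1 _); first by lia.
by rewrite oEE /net_edge; lia.
Qed.

Lemma net_connect_cyc i k : cyc_anc i k -> connect E (o i) (o k).
Proof.
rewrite /cyc_anc => h.
have [h1|h1] := boolP ((i <= k <= p.+1) || (p.+1 < i <= k)).
  by apply: net_connect_range; lia.
have last_edge : connect E (o m) (o p.+1).
  by apply: connect1; rewrite oEE /net_edge; lia.
have [e|ne] := eqVneq k p.+1.
  rewrite e; apply: connect_trans last_edge; apply: net_connect_range; lia.
apply: (@connect_trans _ _ (o p.+2)).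
  by have -> : i = 0 by [lia]; apply: connect1; rewrite oEE /net_edge; lia.
by apply: net_connect_range; lia.
Qed.

Lemma net_connect_leaf i k : 0 < k -> cyc_anc i k -> connect E (o i) (o (m + k)).
Proof.
move=> k0 h; apply: connect_trans (net_connect_cyc h) (connect1 _).
by move: h; rewrite /cyc_anc => h; rewrite oEE /net_edge; lia.
Qed.

(** [u] is a common ancestor below all the others on the cycle, so minimality forces [w] to be [u];
    [i != j] excludes a leaf as [w]. *)
Lemma net_lca i j u w : 0 < i <= m -> 0 < j <= m -> i != j ->
  cyc_anc u i -> cyc_anc u j ->
  (forall w, cyc_anc w i -> cyc_anc w j -> cyc_anc w u) ->
  is_lca E (o (m + i)) (o (m + j)) w -> w = u :> nat.
Proof.
move=> hi hj nij ui uj h /and3P [wi wj /forallP hw].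
have := net_connect_anc wi; have := net_connect_anc wj; rewrite !oK; try lia.
rewrite !addKn => h1 h2.
have [h3 h4] : cyc_anc w i /\ cyc_anc w j.
  by move: h1 h2; rewrite /cyc_anc; lia.
have := hw (o u); rewrite /anc !net_connect_leaf //=; try lia.
rewrite [in connect _ w _](oE w) net_connect_cyc ?h //= => /eqP <-; rewrite oK //.
by move: ui; rewrite /cyc_anc; lia.
Qed.

Definition net_cycle : {set 'I_N} := [set i : 'I_N | i <= m].
Let C := net_cycle.

Lemma net_cycle_interval : C = interval E (o 0) (o p.+1).
Proof.
apply/setP => i; rewrite !inE; apply/idP/andP => [im|[_ /net_connect_anc]].
  by rewrite [i]oE; split; apply: net_connect_cyc; rewrite /cyc_anc; lia.
by rewrite oK /cyc_anc; lia.
Qed.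

Lemma net_cycle_biconn : biconn (undir E) C.
Proof.
rewrite net_cycle_interval.
(* The parents [m] and [p] of the hybrid lie on different sides and have only the root as common
   ancestor. *)
apply: (@ear_biconn _ _ _ (o m) (o p)); first exact: net_acyclic.
- by apply: net_connect_cyc; rewrite /cyc_anc; lia.
- by apply: net_connect_cyc; rewrite /cyc_anc; lia.
- move=> i _ /net_connect_anc; rewrite oK; last lia.
  move=> h1 /net_connect_anc; rewrite oK; last lia.
  by move=> h2; apply: val_inj; rewrite /= oK //; move: h1 h2; rewrite /cyc_anc; lia.
- by apply/negP => /net_connect_anc; rewrite !oK /cyc_anc; lia.
- by rewrite oEE /net_edge; lia.
by apply: net_connect_cyc; rewrite /cyc_anc; lia.
Qed.

(** All vertices outside the cycle are leaves, which are pendant. *)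
Lemma net_biconn_sub (B : {set 'I_N}) : biconn (undir E) B -> 2 < #|B| -> B \subset C.
Proof.
move=> bB B3; apply/subsetP => i iB; rewrite inE leqNgt; apply/negP => mi.
have li := ltn_ord i.
have := biconn_no_pendant (l := i) (c := o (i - m)) bB B3; rewrite iB => h.
have : false.
  apply: h; first by rewrite -val_eqE /= oK; lia.
  move=> z; rewrite undirE !EE /net_edge => hz; apply: val_inj; rewrite /= oK; lia.
by [].
Qed.

Lemma card_net_cycle : #|C| = m.+1.
Proof. by rewrite -[RHS](@card_ord_lt N); [apply: eq_card => i; rewrite !inE|lia]. Qed.

Lemma net_cycle_block : cycle_block E C.
Proof.
have c3 : 2 < #|C| by rewrite card_net_cycle; lia.
split=> //; split; first exact: net_cycle_biconn.
move=> B sB bB; apply/eqP; rewrite eqEsubset sB andbT; apply: net_biconn_sub => //.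
by apply: leq_trans c3 _; apply: subset_leq_card.
Qed.

Lemma net_cycle_block_unique B : cycle_block E B -> B = C.
Proof.
move=> [[bB mB] B3]; apply/esym/mB; last exact: net_cycle_biconn.
exact: net_biconn_sub.
Qed.

Lemma net_elementary : elementary E X.
Proof.
exists C; split; first exact: net_cycle_block.
have cX : X = ~: C by apply/setP => i; rewrite !inE ltnNge.
split; first by move=> v; rewrite cX in_setC; case: (v \in C); [left|right].
split; first by rewrite cX -setI_eq0 setICr.
split.
  have hX : #|X| = m by rewrite cX cardsCs setCK card_net_cycle card_ord; lia.
  by rewrite card_net_cycle hX addn1.
split.
  exists (o p.+1); split; first by rewrite inE oK; lia.
    by rewrite hybridE oK //; lia.
  by move=> w; rewrite hybridE => /eqP e; apply: val_inj; rewrite /= oK; lia.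
exists (o 0); split; first by rewrite inE oK.
- by rewrite net_indeg oK.
- move=> u v; rewrite EE !inE => uv; have [vm|vm] := leqP v m.
    by left; move: uv; rewrite /net_edge; lia.
  right; split=> //; first by move: uv; rewrite /net_edge; lia.
  by move=> e; move: uv; rewrite e oK // /net_edge; lia.
move=> v; rewrite inE => vm nv.
have v0 : (v : nat) != 0 by apply/eqP => e; apply: nv; apply: val_inj; rewrite /= oK.
rewrite -(@card_ord_eq1 N (fun x => (m < x) && net_edge v x) (m + v)).
- by apply: eq_card => i; rewrite !inE.
- by lia.
by move=> i li; rewrite /net_edge; lia.
Qed.

Lemma net_side (s : seq nat) h : path net_edge 0 s -> all (fun i => i <= m) s ->
  uniq (0 :: s) -> last 0 s = h -> side E C (o 0) (o h) (map o s).
Proof.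
move=> ps /allP as_ us ls; apply/and4P; split.
- have : 0 <= m + m by []. move: 0 ps as_ {us ls}.
  elim: s => //= x s IH y /andP [yx ps] h0 ym.
  have xm : x <= m by apply: h0; rewrite mem_head.
  rewrite oEE ?yx //; last by lia.
  by apply: IH => //; [move=> z zs; apply: h0; rewrite inE zs orbT|lia].
- by rewrite last_map ls.
- rewrite -map_cons map_inj_in_uniq // => x y xs ys e.
  have le z : z \in 0 :: s -> z <= m + m.
    by rewrite inE => /orP [/eqP -> //|/as_]; lia.
  by have := congr1 (@nat_of_ord _) e; rewrite !oK ?le.
apply/allP => x /mapP [y /as_ ym ->]; rewrite inE oK //; lia.
Qed.

(** The root has no edge to the hybrid. A [side] omits the root but includes the hybrid, so the two
    sides have sizes [p + 1] and [q + 1]; both being 2 contradicts [2 < p + q]. *)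
Lemma net_strong : 2 < p + q -> strong E.
Proof.
move=> pq B /net_cycle_block_unique ->; case=> r [h [[rC ranc hC hh] w]].
have r0 : r = o 0.
  have := ranc (o 0); rewrite inE oK // => /(_ isT) /net_connect_anc.
  by rewrite oK // => ra; apply: val_inj; rewrite /= oK //; move: ra; rewrite /cyc_anc; lia.
have hE : h = o p.+1.
  by move: hh; rewrite hybridE => /eqP e; apply: val_inj; rewrite /= oK; lia.
rewrite {}r0 {}hE {rC ranc hC hh} in w.
case: w => [|w].
  by case/and4P => /andP [e _] _ _ _; move: e; rewrite oEE /net_edge; lia.
have s1 : side E C (o 0) (o p.+1) (map o (iota 1 p.+1)).
  apply: net_side.
  - by apply: path_iota => j hj; rewrite /net_edge; lia.
  - by apply/allP => i; rewrite mem_iota; lia.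
  - by rewrite cons_uniq iota_uniq mem_iota.
  exact: last_iota.
have s2 : side E C (o 0) (o p.+1) (map o (rcons (iota p.+2 q) p.+1)).
  apply: net_side.
  - have -> : iota p.+2 q = p.+2 :: iota p.+3 q.-1 by rewrite -{1}(prednK q0).
    rewrite /= rcons_path.
    have -> : last p.+2 (iota p.+3 q.-1) = m.
      by rewrite -[LHS]/(last 0 (iota p.+2 q.-1.+1)) last_iota; lia.
    apply/and3P; split; try by rewrite /net_edge; lia.
    by apply: path_iota => j hj; rewrite /net_edge; lia.
  - by apply/allP => i; rewrite mem_rcons inE mem_iota; lia.
  - by rewrite cons_uniq rcons_uniq iota_uniq mem_rcons inE !mem_iota; lia.
  by rewrite last_rcons.
have := w _ s1; have := w _ s2.
by rewrite !size_map size_rcons !size_iota; lia.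
Qed.

Variable t0 : bool.

(* The colour of the hybrid [p + 1] is immaterial: it is the lca of no two leaves. *)
Definition net_color (i : nat) : bool := t0 (+) odd (if i <= p.+1 then i else i - p.+1).

Definition net_label (i : 'I_N) : lab :=
  if m < i then Ldot else if net_color i then L1 else L0.

Lemma net_labeled : labeled X net_label.
Proof. by move=> v; rewrite /net_label inE; case: ltnP => //; case: (net_color v). Qed.

(** [net_color] follows the parity of the distance from the root along a side, which changes on
    every cycle edge not entering the hybrid. *)
Lemma net_quasi_discriminating : quasi_discriminating E X net_label.
Proof.
move=> u v; rewrite EE !inE hybridE => uv um vm nv.
rewrite /net_label (negbTE um) (negbTE vm).
have : net_color u != net_color v; last by case: (net_color u); case: (net_color v).
rewrite /net_color; case: (t0); move: uv um vm nv; rewrite /net_edge;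
  have [h1|h1] := leqP u p.+1; have [h2|h2] := leqP v p.+1; lia.
Qed.


End Cycle.

(** * From alternating lists to the network and the polar-cat *)

Lemma two_alt_caterps_uniq (T : finType) (g : rel T) v a b t0 :
  two_alt_caterps g v a b t0 ->
  [/\ uniq (v :: a), uniq (v :: b) & forall x, x \in b -> x \notin a].
Proof.
move=> [[+ _ _ _] _]; rewrite /= mem_cat negb_or cat_uniq.
by case/andP => /andP [-> ->] /and3P [-> /hasPn h ->].
Qed.

(** The vertices sit on the cycle in the order [a], [v], [b], from position 1 on, which puts [v] at
    the hybrid. The vertex [u] is the root for vertices on different sides, and otherwise the
    position of the one nearer the root. *)
Lemma two_alt_caterps_color (T : finType) (g : rel T) v a b t0 x y :
  symmetric g -> two_alt_caterps g v a b t0 -> x != y ->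
  let pos x := (index x (a ++ v :: b)).+1 in
  exists u, [/\ cyc_anc (size a) (size b) u (pos x), cyc_anc (size a) (size b) u (pos y),
    forall w, cyc_anc (size a) (size b) w (pos x) -> cyc_anc (size a) (size b) w (pos y) ->
      cyc_anc (size a) (size b) w u &
    g x y = net_color (size a) t0 u].
Proof.
move=> gs tac nxy pos.
have [ua ub nba] := two_alt_caterps_uniq tac.
case: tac => [[_ cov _ _] [alta altb cross]].
set p := size a; set q := size b.
have posa z : z \in a -> pos z = (index z a).+1 by rewrite /pos index_cat => ->.
have va : v \notin a by case/andP: ua.
have vb : v \notin b by case/andP: ub.
have posv : pos v = p.+1 by rewrite /pos index_cat (negbTE va) /= eqxx addn0.
have posb z : z \in b -> pos z = p.+2 + index z b.
  move=> zb; rewrite /pos index_cat (negbTE (nba z zb)) /=.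
  by case: eqVneq vb => [->|_ _]; [rewrite zb|rewrite addnS addSn].
have idxa z : z \in a -> index z (rcons a v) = index z a.
  by rewrite -cats1 index_cat => ->.
have idxb z : z \in b -> index z (rcons b v) = index z b.
  by rewrite -cats1 index_cat => ->.
have idxv s : v \notin s -> index v (rcons s v) = size s.
  by rewrite -cats1 index_cat => /negbTE ->; rewrite /= eqxx addn0.
have lta z : z \in a -> index z a < p by rewrite index_mem.
have ltb z : z \in b -> index z b < q by rewrite index_mem.
have case3 z : [\/ z \in a, z = v | z \in b].
  have := cov z; rewrite inE mem_cat => /or3P [/eqP|za|zb]; [exact: Or32|exact: Or31|exact: Or33].
pose goal x y := exists u, [/\ cyc_anc p q u (pos x), cyc_anc p q u (pos y),
    forall w, cyc_anc p q w (pos x) -> cyc_anc p q w (pos y) -> cyc_anc p q w u &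
    g x y = net_color p t0 u].
have sym z z' : goal z z' -> goal z' z.
  by case=> u [h1 h2 h3 h4]; exists u; split=> // [w w1 w2|]; [exact: h3|rewrite gs].
have aa z z' : z \in a -> z' \in v :: a -> index z (rcons a v) < index z' (rcons a v) ->
    goal z z'.
  move=> za z'a lt; exists (index z a).+1.
  have := alt_caterp_index alta ua z'a lt; move: lt; rewrite (idxa z za) => lt ->.
  have pz' : pos z' = (index z' (rcons a v)).+1.
    move: z'a; rewrite inE => /orP [/eqP ->|h]; last by rewrite posa // idxa.
    by rewrite posv idxv.
  have : index z' (rcons a v) <= p.
    by rewrite -ltnS -[p.+1](size_rcons a v) index_mem mem_rcons.
  rewrite pz' (posa z za) => le; have := lta z za => lz.
  rewrite /net_color ifT; last by lia.
  move: (index z a) (index z' (rcons a v)) lt le lz => i j lt le lz.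
  by split; rewrite /cyc_anc /=; try lia; case: (t0); rewrite /= ?negbK.
have bb z z' : z \in b -> z' \in v :: b -> index z (rcons b v) < index z' (rcons b v) ->
    goal z z'.
  move=> zb z'b lt; exists (p.+2 + index z b).
  have := alt_caterp_index altb ub z'b lt; move: lt; rewrite (idxb z zb) => lt ->.
  have lz := ltb z zb.
  rewrite /net_color ifF; last by lia.
  have -> : p.+2 + index z b - p.+1 = (index z b).+1 by lia.
  have pz' : pos z' = p.+1 \/ pos z' = p.+2 + index z' (rcons b v) /\ pos z' <= (p + q).+1.
    move: z'b; rewrite inE => /orP [/eqP ->|h]; [by left|right].
    by rewrite posb // idxb //; have := ltb z' h; lia.
  rewrite (posb z zb); move: pz'; move: (pos z') => k pz'.
  by split; rewrite /cyc_anc /=; try lia; case: (t0); rewrite /= ?negbK.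
have ab z z' : z \in a -> z' \in b -> goal z z'.
  move=> za zb; exists 0; rewrite (cross z z' za zb) (posa z za) (posb z' zb).
  have := lta z za; have := ltb z' zb.
  by split; rewrite /cyc_anc /net_color /=; try lia; rewrite addbF.
have same s : uniq (v :: s) -> v \notin s -> x \in v :: s -> y \in v :: s ->
    index x (rcons s v) != index y (rcons s v).
  move=> us vs xs ys; apply: contra nxy => /eqP e; apply/eqP.
  by rewrite -(nth_index v (s := rcons s v) (x := x)) ?mem_rcons // e nth_index ?mem_rcons.
have sideP s z z' : uniq (v :: s) -> v \notin s -> z \in v :: s -> z' \in v :: s ->
   index z (rcons s v) < index z' (rcons s v) -> z \in s.
  move=> us vs; rewrite inE => /orP [/eqP -> zs|//]; rewrite idxv // => lt.
  have : index z' (rcons s v) < size (rcons s v) by rewrite index_mem mem_rcons.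
  by rewrite size_rcons ltnS leqNgt lt.
have va' z : z \in a -> z \in v :: a by rewrite inE => ->; rewrite orbT.
have vb' z : z \in b -> z \in v :: b by rewrite inE => ->; rewrite orbT.
have onA : x \in v :: a -> y \in v :: a -> goal x y.
  move=> xa ya; have := same a ua va xa ya; rewrite neq_ltn => /orP [] lt.
    by apply: aa => //; apply: (sideP a x y).
  by apply/sym/aa => //; apply: (sideP a y x).
have onB : x \in v :: b -> y \in v :: b -> goal x y.
  move=> xb yb; have := same b ub vb xb yb; rewrite neq_ltn => /orP [] lt.
    by apply: bb => //; apply: (sideP b x y).
  by apply/sym/bb => //; apply: (sideP b y x).
case: (case3 x) => hx; case: (case3 y) => hy.
- by apply: onA; apply: va'.
- by apply: onA; [apply: va'|rewrite hy mem_head].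
- exact: ab.
- by apply: onA; [rewrite hx mem_head|apply: va'].
- by rewrite hx hy eqxx in nxy.
- by apply: onB; [rewrite hx mem_head|apply: vb'].
- by apply/sym/ab.
- by apply: onB; [apply: vb'|rewrite hy mem_head].
by apply: onB; apply: vb'.
Qed.

Lemma two_alt_caterps_network (T : finType) (g : rel T) v a b t0 :
  symmetric g -> 4 <= #|T| -> two_alt_caterps g v a b t0 ->
  exists (V : finType) (E : rel V) (X : {set V}) (t : V -> lab) (phi : T -> V),
      [/\ network E X, labeled X t, strong E, elementary E X &
          quasi_discriminating E X t] /\ explains_on g setT E X t phi.
Proof.
move=> gs cT tac.
have color := two_alt_caterps_color gs tac.
have [[un cov p0 q0] _] := tac.
set p := size a in p0 color *; set q := size b in q0 color *.
set m := (p + q).+1.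
set s := a ++ v :: b in color.
have ps : perm_eq s (v :: a ++ b) by rewrite /s perm_catC /= perm_cons perm_catC.
have us : uniq s by rewrite (perm_uniq ps).
have ms x : x \in s by rewrite (perm_mem ps).
have ss : size s = m by rewrite size_cat /= addnS.
have cm : #|T| = m by rewrite -ss -(card_uniqP us); apply: eq_card => x; rewrite !inE ms.
have li x : index x s < m by rewrite -ss index_mem.
(* The index is shifted by one because the root 0 of the cycle carries no leaf. *)
pose phi (x : T) : 'I_(m + m).+1 := inord (m + (index x s).+1).
have phiE x : phi x = m + (index x s).+1 :> nat.
  by rewrite inordK // ltnS leq_add2l li.
exists 'I_(m + m).+1, (@net_rel p q), (@net_leaves p q), (@net_label p q t0), phi.
split; first split.
- exact: net_network.
- exact: net_labeled.
(* As [#|T|] is [p + q + 1], four vertices give [2 < p + q]. *)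
- by apply: net_strong => //; move: cT; rewrite cm /m; lia.
- exact: net_elementary.
- exact: net_quasi_discriminating.
split; [|split].
- move=> x y _ _ e; have := congr1 (@nat_of_ord _) e; rewrite !phiE => /addnI [e'].
  by rewrite -(nth_index v (ms x)) e' nth_index.
- apply/setP => i; rewrite inE; apply/idP/imsetP => [mi|[x _ ->]].
    have lt : i - m.+1 < size s by rewrite ss; have := ltn_ord i; lia.
    exists (nth v s (i - m.+1)) => //.
    apply: val_inj; rewrite /= phiE index_uniq //.
    by rewrite -addSnnS subnKC.
  by rewrite phiE; lia.
move=> x y _ _ nxy w lw.
have [u [u1 u2 u3 ->]] := color x y nxy.
have wu : w = u :> nat.
  apply: (net_lca p0 q0 _ _ _ u1 u2 u3) lw; first by rewrite /= li.
    by rewrite /= li.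
  by rewrite eqSS; apply: contra nxy => /eqP e; rewrite -(nth_index v (ms x)) e nth_index.
rewrite /net_label wu ltnNge.
have -> : u <= m by case/and3P: u1.
by case: (net_color p t0 u).
Qed.

(** For [t0 = false] the top entry of each list is adjacent to its whole part, so both parts are
    connected; for [t0 = true] it is isolated in its part, so both are disconnected. This is the
    polarizing condition. *)
Lemma two_alt_caterps_polar_cat (T : finType) (g : rel T) v a b t0 :
  symmetric g -> irreflexive g -> 4 <= #|T| -> two_alt_caterps g v a b t0 -> polar_cat g.
Proof.
move=> gs gi cT tac.
have [ua ub nba] := two_alt_caterps_uniq tac.
have [[un cov p0 q0] [alta altb cross]] := tac.
have va : v \notin a by case/andP: ua.
have vb : v \notin b by case/andP: ub.
have card s : uniq (v :: s) -> 0 < size s -> 1 < #|[set x in v :: s]|.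
  by move=> us s0; rewrite cardsE (card_uniqP us).
have connected s : alt_caterp g v true s -> 0 < size s -> conn_on g [set x in v :: s].
  case: s => // x s [hx _] _.
  apply: (@conn_on_hub _ _ _ x) => // z; rewrite inE => zs.
  have [->|nzx] := eqVneq z x; first exact: connect0.
  apply: connect1; rewrite restrE !inE eqxx orbT /= gs hx.
    by move: zs; rewrite !inE => ->.
  by move: zs; rewrite !inE (negbTE nzx).
have disconnected s : uniq (v :: s) -> alt_caterp g v false s -> 0 < size s ->
    ~ conn_on g [set x in v :: s].
  case: s => // x s us [hx _] _ cn.
  have nxv : x != v.
    by move: us; rewrite /= inE negb_or eq_sym => /andP [/andP [->]].
  have xW : x \in [set z in v :: x :: s] by rewrite !inE eqxx orbT.
  have vW : v \in [set z in v :: x :: s] by rewrite !inE eqxx.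
  have [z] := connect_edge (cn x v xW vW) nxv.
  rewrite restrE => /and3P [_ zW gxz].
  have [e|nzx] := eqVneq z x; first by rewrite e gi in gxz.
  by move: gxz; rewrite hx //; move: zW; rewrite !inE (negbTE nzx).
have part x y : x \in [set x in v :: a] :\ v -> y \in [set x in v :: b] :\ v -> g x y = t0.
  rewrite !inE => /andP [/negbTE -> xa] /andP [/negbTE -> yb]; exact: cross.
exists v, [set x in v :: a], [set x in v :: b]; split; [|split=> //; split].
- split; [|split; [|split]].
  + split; [| |exact: card|exact: card].
      by apply/setP => x; have := cov x; rewrite !inE mem_cat; case: (x == v).
    apply/setP => x; rewrite !inE; case: (x == v) => //=.
    by apply/negP => /andP [xa /nba]; rewrite xa.
  + by apply: (alt_caterp_cograph gs alta) => x; rewrite inE.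
  + by apply: (alt_caterp_cograph gs altb) => x; rewrite inE.
  by case: (t0) part => h; [left|right] => x y xa yb; rewrite h.
- case: (t0) alta altb part => /= alta altb part; [right|left].
    split; [exact: disconnected|split; [exact: disconnected|]].
    by move=> x y xa yb; rewrite part.
  split; [exact: connected|split; [exact: connected|]].
  by move=> x y xa yb; rewrite part.
split; first exact: alt_caterp_cat_with_cherry gs ua p0 alta.
exact: alt_caterp_cat_with_cherry gs ub q0 altb.
Qed.

(** An elementary network has a single hybrid vertex altogether. *)
Lemma elementary_level1 (V : finType) (E : rel V) (X : {set V}) :
  elementary E X -> level1 E.
Proof.
case=> C [_ [_ [_ [_ [[h [_ _ uh]] _]]]]] B _.
rewrite -(cards1 h); apply/subset_leq_card/subsetP => z.
by rewrite !inE => /andP [_ /uh ->].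
Qed.

Theorem mainTheorem2 (T : finType) (g : rel T) :
  symmetric g -> irreflexive g -> primitive g ->
  let C1 := exists (V : finType) (E : rel V) (X : {set V}) (t : V -> lab) (phi : T -> V),
      [/\ network E X, level1 E, labeled X t & explains_on g setT E X t phi] in
  let C2 := exists (V : finType) (E : rel V) (X : {set V}) (t : V -> lab) (phi : T -> V),
      [/\ network E X, labeled X t, strong E, elementary E X &
          quasi_discriminating E X t] /\ explains_on g setT E X t phi in
  let C3 := polar_cat g in
  (C1 <-> C2) /\ (C2 <-> C3).
Proof.
move=> gs gi pr C1 C2 C3.
have C21 : C2 -> C1.
  case=> V [E [X [t [phi [[net lb _ el _] ex]]]]]; exists V, E, X, t, phi.
  by split=> //; apply: elementary_level1 el.
have C1tc : C1 -> two_caterps g.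
  case=> V [E [X [t [phi [net l1 _ ex]]]]].
  exact: level1_network_two_caterps gs pr net l1 ex.
have C3tc : C3 -> two_caterps g := @polar_cat_two_caterps T g.
have tcC2 : two_caterps g -> C2.
  move/(two_caterps_alt gs pr) => [v [a [b [t0 tac]]]].
  exact: two_alt_caterps_network gs pr.1 tac.
have tcC3 : two_caterps g -> C3.
  move/(two_caterps_alt gs pr) => [v [a [b [t0 tac]]]].
  exact: two_alt_caterps_polar_cat gs gi pr.1 tac.
split; split; [by move/C1tc|exact: C21|by move/C21/C1tc|by move/C3tc].
Qed.
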